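(* Every general safe recursive function $f:\mathcal T(\mathcal C)^{k+l}\to\mathcal T(\mathcal C)$ can be computed by a constructor GRS $\mathcal G$ that is precedence terminating with argument separation and for which there is a constant $d\ge\max\big(\{\mathrm{ar}(g):g\in\mathcal F\}\cup\{|K{\restriction}r|:(K,l,r)\in\mathcal G_{\mathrm{fin}}\}\big)$ such that every rule $(K,l,r)\in\mathcal G_{\mathrm{inf}}$ satisfies: (i) $(K{\restriction}l)\cap\mathrm{nrm}$ is maximally shared; (ii) $K{\restriction}v$ is closed for every labeled $v\in\mathrm{nrm}(l)$; (iii) $\big|\{v\in\mathrm{nrm}(l):v\text{ unlabeled}\}\cup\bigcup_{v\in\mathrm{safe}(l)}V_{K\restriction v}\big|\le d$; (iv) $|K{\restriction}r|\le|K{\restriction}l|+\big|\bigcup_{v\in\mathrm{nrm}(r)}V_{K\restriction v}\big|$.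
   Context: General safe recursive functions. Fix a finite set $\mathcal C$ of constructors containing at least one constant, enumerated $c_1,\dots,c_{|\mathcal C|}$; $\mathcal T(\mathcal C)$ is the set of ground constructor terms. Functions carry a separation of arguments into normal and safe ones, written $f(x_1,\dots,x_k;y_1,\dots,y_l)$. The general safe recursive functions are the least class containing: constants $O^{k,l}_j(\vec x;\vec y)=c_j$ ($c_j$ a constant); constructors $C_j(;x_1,\dots,x_{\mathrm{ar}(c_j)})=c_j(x_1,\dots,x_{\mathrm{ar}(c_j)})$; projections $I^{k,l}_j(x_1,\dots,x_k;x_{k+1},\dots,x_{k+l})=x_j$; predecessors $P_{i,0}(;c_i)=c_i$ for constant $c_i$ and $P_{i,j}(;c_i(x_1,\dots,x_{\mathrm{ar}(c_i)}))=x_j$; conditional $C(;c_j(\vec x),y_1,\dots,y_{|\mathcal C|})=y_j$; and closed under safe composition $f(\vec x;\vec y)=h(x_{j_1},\dots,x_{j_m};g_1(\vec x;\vec y),\dots,g_n(\vec x;\vec y))$ with $\{j_1,\dots,j_m\}\subseteq\{1,\dots,k\}$, and general safe recursion $f(c_j(x_1,\dots,x_{\mathrm{ar}(c_j)}),\vec y;\vec z)=h_j(\vec x,\vec y;\vec z,f(x_1,\vec y;\vec z),\dots,f(x_{\mathrm{ar}(c_j)},\vec y;\vec z))$ for each constructor $c_j$ (for constants: $f(c_j,\vec y;\vec z)=h_j(\vec y;\vec z)$). Term graphs. $\mathcal F=\mathcal C\cup\mathcal D$ is a finite signature with arity $\mathrm{ar}$. A labeled graph: finite acyclic directed graph $(V_G,E_G)$,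 partial labeling $\mathrm{lab}_G:V_G\to\mathcal F$, successor function $\mathrm{att}_G:V_G\to V_G^*$ with $\mathrm{att}_G(v)$ of length $\mathrm{ar}(\mathrm{lab}_G(v))$ if $v$ is labeled and empty otherwise, its entries being exactly the $E_G$-successors of $v$. A term graph has a root $\rho_G$ from which all nodes are reachable; $\mathcal{TG}(\mathcal F)$, $\mathcal{TG}(\mathcal C)$ as usual. $G{\restriction}v$ is the sub-term graph rooted at $v$; $|G|=|V_G|$. Closed: all nodes labeled. Basic: $\mathrm{lab}_G(\rho_G)\in\mathcal D$ and $G{\restriction}v\in\mathcal{TG}(\mathcal C)$ for each successor $v$ of $\rho_G$. Each $G{\restriction}v$ has a term representation (unlabeled nodes as distinct variables); $G$ is maximally shared if distinct nodes have distinct term representations. Ground constructor terms are represented by closed term graphs over $\mathcal C$. Argument separation. Argument positions of each symbol are split into normal and safe; constructors have only safe positions; nodes with the same label have the same separation. $\mathrm{nrm}(v)$, $\mathrm{safe}(v)$ are the successors of $v$ at normal, resp. safe, positions. $H\sqsubset_{\mathrm{nrm}}G$ means $H=(G{\restriction}v){\restriction}u$ for some $v\in\mathrm{nrm}(\rho_G)$ and node $u$. For $G$ with $\mathrm{att}_G(\rho_G)=v_1,\dots,v_k;v_{k+1},\dots,v_{k+l}$, $G\cap\mathrm{nrm}$ is the term graph with root $\rho_G$ whose nodes are $\rho_G$, the nodes of $G{\restriction}v$ for $v\in\mathrm{nrm}(\rho_G)$, and $l$ fresh unlabeled nodes $u_1,\dots,u_l$, with $\mathrm{att}(\rho_G)=v_1,\dots,v_k;u_1,\dots,u_l$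 (if no safe successor of the root is labeled, $G\cap\mathrm{nrm}=G$). Rewriting. Homomorphisms preserve labels, successor sequences at labeled nodes and the normal/safe split. A graph rewrite rule $(K,l,r)$: labeled graph $K$, distinct nodes $l,r$, every unlabeled node of $K{\restriction}r$ in $K{\restriction}l$; constructor rule if $K{\restriction}l$ is basic. A GRS is a possibly infinite set of rules; a constructor GRS consists of constructor rules. The step $G\to_{\mathcal G}H$ via a rule $(K,l,r)$ and homomorphism $\varphi:K{\restriction}l\to G$ is the standard build/redirection/garbage-collection step replacing $G{\restriction}\varphi(l)$ by an instance of $K{\restriction}r$. $\mathcal D_{\mathrm{inf}}$: defined symbols labeling the left root of infinitely many rules; $\mathcal G_{\mathrm{inf}}$: rules whose left root label is in $\mathcal D_{\mathrm{inf}}$; $\mathcal G_{\mathrm{fin}}=\mathcal G\setminus\mathcal G_{\mathrm{inf}}$. A GRS computes $f$ if some defined symbol $\mathsf f$ with the same argument separation satisfies: for all inputs $\vec t$, every maximal rewrite sequence from the maximally shared closed basic term graph representing $\mathsf f(\vec t)$ is finite and ends in a closed term graph over $\mathcal C$ representing $f(\vec t)$. Precedence termination with argument separation. A precedence $\sqsubset$ is a well-founded strict partial order on $\mathcal F$ with constructors minimal. $H\sqsubset_{\mathrm{pt}}G$ holds if $\mathrm{lab}_H(v)\sqsubset\mathrm{lab}_G(\rho_G)$ for every labeled node $v$ of $H$ and either (1) $H=G{\restriction}u$ or $H\sqsubset_{\mathrm{pt}}G{\restriction}u$ for some successor $u$ of $\rho_G$; or (2) $\rho_H$ is labeled, $H{\restriction}v\sqsubset_{\mathrm{nrm}}G$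 for each $v\in\mathrm{nrm}(\rho_H)$, and $H{\restriction}v\sqsubset_{\mathrm{pt}}G$ for each $v\in\mathrm{safe}(\rho_H)$. A GRS is precedence terminating with argument separation if for some separation and precedence, $K{\restriction}r\sqsubset_{\mathrm{pt}}K{\restriction}l$ for every rule. *)

(* Defs.v *)
From Stdlib Require Import Relations.
From Stdlib Require List.
From mathcomp Require Import all_boot.
Set Implicit Arguments.
Unset Strict Implicit.
Unset Printing Implicit Defensive.

Inductive cterm (nC : nat) : Type := CT of 'I_nC & seq (cterm nC).

Section GroundTerms.
Variables (nC : nat) (arC : 'I_nC -> nat).

Fixpoint wf_ct (t : cterm nC) : bool :=
  let: CT c ts := t in (size ts == arC c) && all wf_ct ts.

Definition inputs (k l : nat) (xs ys : seq (cterm nC)) : Prop :=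
  [/\ size xs = k, size ys = l, all wf_ct xs & all wf_ct ys].

Definition fn := seq (cterm nC) -> seq (cterm nC) -> cterm nC.

Definition sel (xs : seq (cterm nC)) (js : seq nat) := pmap (onth xs) js.

(* General safe recursive functions f(x_1..x_k; y_1..y_l), as the least
   class of (extensional, on valid inputs) functions. Indices are 0-based. *)
Inductive GSR : nat -> nat -> fn -> Prop :=
| GSR_const k l (j : 'I_nC) (f : fn) :
    arC j = 0 ->
    (forall xs ys, inputs k l xs ys -> f xs ys = CT j [::]) -> GSR k l f
| GSR_cons (j : 'I_nC) (f : fn) :
    (forall xs ys, inputs 0 (arC j) xs ys -> f xs ys = CT j ys) ->
    GSR 0 (arC j) f
| GSR_proj k l (j : nat) (f : fn) :
    j < k + l ->
    (forall xs ys, inputs k l xs ys -> onth (xs ++ ys) j = Some (f xs ys)) ->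
    GSR k l f
| GSR_pred0 (i : 'I_nC) (f : fn) :
    arC i = 0 ->
    (forall xs ys t, inputs 0 1 xs ys -> ys = [:: t] -> f xs ys = t) ->
    GSR 0 1 f
| GSR_pred (i : 'I_nC) (j : nat) (f : fn) :
    j < arC i ->
    (forall xs ys c ts, inputs 0 1 xs ys -> ys = [:: CT c ts] ->
       f xs ys = if c == i then nth (CT c ts) ts j else CT c ts) ->
    GSR 0 1 f
| GSR_cond (f : fn) :
    (forall xs ys c ts us, inputs 0 nC.+1 xs ys -> ys = CT c ts :: us ->
       f xs ys = nth (CT c ts) us c) ->
    GSR 0 nC.+1 f
| GSR_comp k l m n (h : fn) (js : seq nat) (gs : seq fn) (f : fn) :
    GSR m n h -> size js = m -> all (fun j => j < k) js ->
    size gs = n -> (forall g, List.In g gs -> GSR k l g) ->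
    (forall xs ys, inputs k l xs ys ->
       f xs ys = h (sel xs js) [seq g xs ys | g <- gs]) ->
    GSR k l f
| GSR_rec k l (hs : 'I_nC -> fn) (f : fn) :
    (forall c, GSR (arC c + k) (l + arC c) (hs c)) ->
    (forall c ts xs ys, inputs (arC c + k) l (ts ++ xs) ys -> size ts = arC c ->
       f (CT c ts :: xs) ys =
       hs c (ts ++ xs) (ys ++ [seq f (t :: xs) ys | t <- ts])) ->
    GSR k.+1 l f.
End GroundTerms.

Record sig (nC : nat) (arC : 'I_nC -> nat) := Sig {
  nD : nat;
  arD : 'I_nD -> nat;
  (* snrm s i = true iff argument position i (0-based) of s is normal *)
  snrm : ('I_nC + 'I_nD)%type -> nat -> bool }.
Arguments nD {nC arC} s.
Arguments arD {nC arC} s _.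
Arguments snrm {nC arC} s _ _.

Section Graphs.
Variables (nC : nat) (arC : 'I_nC -> nat) (S : sig arC).

Definition sym := ('I_nC + 'I_(nD S))%type.
Definition ar (s : sym) : nat :=
  match s with inl c => arC c | inr g => arD S g end.
Definition is_con (o : option sym) : bool :=
  if o is Some (inl _) then true else false.

Inductive gterm : Type := GVar of nat | GApp of sym & seq gterm.

Fixpoint embed (t : cterm nC) : gterm :=
  let: CT c ts := t in GApp (inl c) [seq embed u | u <- ts].

Record tgraph := TG {
  tlab : nat -> option sym;
  tatt : nat -> seq nat;
  tnodes : seq nat;
  troot : nat }.

Fixpoint desc (att : nat -> seq nat) (n v : nat) : seq nat :=
  if n is n'.+1 then v :: flatten [seq desc att n' u | u <- att v] else [:: v].

Definition sub_of (lab : nat -> option sym) (att : nat -> seq nat) (fuel v : nat) : tgraph :=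
  TG lab att (undup (desc att fuel v)) v.

Definition tsub (G : tgraph) (v : nat) : tgraph :=
  sub_of (tlab G) (tatt G) (size (tnodes G)) v.

Definition succ (att : nat -> seq nat) : relation nat := fun u w => w \in att u.

Definition wf_tgraph (G : tgraph) : Prop :=
  [/\ uniq (tnodes G), troot G \in tnodes G,
      (forall v, v \in tnodes G ->
         all (mem (tnodes G)) (tatt G v) /\
         size (tatt G v) = (if tlab G v is Some f then ar f else 0)),
      (forall v, v \in tnodes G -> ~ clos_trans nat (succ (tatt G)) v v) &
      (forall v, v \in tnodes G -> clos_refl_trans nat (succ (tatt G)) (troot G) v)].

Fixpoint trep_f (lab : nat -> option sym) (att : nat -> seq nat) (n v : nat) : gterm :=
  if n is n'.+1 then
    (if lab v is Some f then GApp f [seq trep_f lab att n' u | u <- att v]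
     else GVar v)
  else GVar v.
Definition trep (G : tgraph) (v : nat) : gterm :=
  trep_f (tlab G) (tatt G) (size (tnodes G)) v.

Definition max_shared (G : tgraph) : Prop :=
  forall u w, u \in tnodes G -> w \in tnodes G -> u <> w -> trep G u <> trep G w.
Definition closed (G : tgraph) : Prop :=
  forall v, v \in tnodes G -> tlab G v <> None.
Definition over_C (G : tgraph) : Prop :=
  forall v, v \in tnodes G -> is_con (tlab G v).

Definition nrm_of (lab : nat -> option sym) (att : nat -> seq nat) (v : nat) : seq nat :=
  if lab v is Some f then
    [seq nth 0 (att v) i | i <- iota 0 (size (att v)) & snrm S f i]
  else [::].
Definition safe_of (lab : nat -> option sym) (att : nat -> seq nat) (v : nat) : seq nat :=
  if lab v is Some f then
    [seq nth 0 (att v) i | i <- iota 0 (size (att v)) & ~~ snrm S f i]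
  else [::].

Definition cap_nrm (G : tgraph) : tgraph :=
  let r := troot G in
  if has (fun v => tlab G v != None) (safe_of (tlab G) (tatt G) r) then
    let m := (foldr maxn 0 (tnodes G)).+1 in
    let f := tlab G r in
    let isn i := if f is Some g then snrm S g i else false in
    let n := size (tatt G r) in
    let attr := [seq (if isn i then nth 0 (tatt G r) i else m + i) | i <- iota 0 n] in
    TG (fun w => if m <= w then None else tlab G w)
       (fun w => if w == r then attr else if m <= w then [::] else tatt G w)
       (undup (r :: flatten [seq tnodes (tsub G v) | v <- nrm_of (tlab G) (tatt G) r]
                  ++ [seq m + i | i <- iota 0 n & ~~ isn i]))
       r
  else G.

(* labeled graphs (for rules) with node set {0,...,gsz-1} *)
Record lgraph := LG {
  gsz : nat;
  glab : nat -> option sym;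
  gatt : nat -> seq nat }.

Definition wf_lgraph (K : lgraph) : Prop :=
  [/\ (forall v, v < gsz K ->
         all (fun u => u < gsz K) (gatt K v) /\
         size (gatt K v) = (if glab K v is Some f then ar f else 0)),
      (forall v, gsz K <= v -> glab K v = None /\ gatt K v = [::]) &
      (forall v, v < gsz K -> ~ clos_trans nat (succ (gatt K)) v v)].

Definition ksub (K : lgraph) (v : nat) : tgraph :=
  sub_of (glab K) (gatt K) (gsz K) v.
Definition knrm (K : lgraph) v := nrm_of (glab K) (gatt K) v.
Definition ksafe (K : lgraph) v := safe_of (glab K) (gatt K) v.

Record rule := Rule { rK : lgraph; rl : nat; rr : nat }.

Definition wf_rule (p : rule) : Prop :=
  [/\ wf_lgraph (rK p), rl p < gsz (rK p), rr p < gsz (rK p), rl p <> rr p &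
      forall u, u \in tnodes (ksub (rK p) (rr p)) -> glab (rK p) u = None ->
        u \in tnodes (ksub (rK p) (rl p))].

Definition constructor_rule (p : rule) : Prop :=
  let K := rK p in
  (exists g, glab K (rl p) = Some (inr g)) /\
  forall v, v \in gatt K (rl p) -> forall u, u \in tnodes (ksub K v) ->
    glab K u = None \/ is_con (glab K u).

Definition homom (H G : tgraph) (phi : nat -> nat) : Prop :=
  forall u, u \in tnodes H -> phi u \in tnodes G /\
    forall f, tlab H u = Some f ->
      tlab G (phi u) = Some f /\ tatt G (phi u) = [seq phi x | x <- tatt H u].

Definition new_nodes (p : rule) : seq nat :=
  [seq u <- tnodes (ksub (rK p) (rr p)) | u \notin tnodes (ksub (rK p) (rl p))].

(* build / redirection / garbage collection *)
Definition rw_result (G : tgraph) (p : rule) (phi psi : nat -> nat) : tgraph :=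
  let K := rK p in
  let L := ksub K (rl p) in
  let nn := new_nodes p in
  let chi u := if u \in tnodes L then phi u else psi u in
  let w := phi (rl p) in
  let r' := chi (rr p) in
  let red x := if x == w then r' else x in
  let idx x := find (fun u => psi u == x) nn in
  let lab1 x := if idx x < size nn then glab K (nth 0 nn (idx x)) else tlab G x in
  let att2 x := [seq red y | y <- if idx x < size nn
                    then [seq chi z | z <- gatt K (nth 0 nn (idx x))]
                    else tatt G x] in
  let root2 := red (troot G) in
  TG lab1 att2 (undup (desc att2 (size (tnodes G) + size nn) root2)) root2.

Definition tg_eq (G H : tgraph) : Prop :=
  [/\ troot G = troot H, tnodes G =i tnodes H &
      forall v, v \in tnodes G -> tlab G v = tlab H v /\ tatt G v = tatt H v].

Definition step (R : rule -> Prop) (G H : tgraph) : Prop :=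
  exists p phi psi, [/\ R p,
    homom (ksub (rK p) (rl p)) G phi,
    (forall u, u \in new_nodes p -> psi u \notin tnodes G),
    {in new_nodes p &, injective psi} &
    tg_eq H (rw_result G p phi psi)].

Definition computes (R : rule -> Prop) (g : 'I_(nD S)) (k l : nat)
    (f : fn nC) : Prop :=
  [/\ arD S g = k + l,
      (forall i, i < k + l -> snrm S (inr g) i = (i < k)) &
      forall xs ys, inputs arC k l xs ys ->
      forall G0, wf_tgraph G0 -> closed G0 -> max_shared G0 ->
        trep G0 (troot G0) = GApp (inr g) [seq embed t | t <- xs ++ ys] ->
        Acc (fun H G => step R G H) G0 /\
        forall H, clos_refl_trans tgraph (step R) G0 H ->
          ~ (exists H', step R H H') ->
          over_C H /\ trep H (troot H) = embed (f xs ys)].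

Definition precedence (prec : sym -> sym -> Prop) : Prop :=
  [/\ (forall s, ~ prec s s),
      (forall a b c, prec a b -> prec b c -> prec a c),
      well_founded prec &
      (forall c s, ~ prec s (inl c))].

Section PT.
Variables (K : lgraph) (prec : sym -> sym -> Prop).

Definition lab_below (h g : nat) : Prop :=
  forall v f', v \in tnodes (ksub K h) -> glab K v = Some f' ->
    exists f, glab K g = Some f /\ prec f' f.

Inductive pt : nat -> nat -> Prop :=
| pt_sub h g u : lab_below h g -> u \in gatt K g -> (u = h \/ pt h u) -> pt h g
| pt_arg h g : lab_below h g -> glab K h <> None ->
    (forall v, v \in knrm K h ->
       exists v', v' \in knrm K g /\ v \in tnodes (ksub K v')) ->
    (forall v, v \in ksafe K h -> pt v g) -> pt h g.
End PT.

Definition prec_terminating (R : rule -> Prop) : Prop :=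
  exists prec, precedence prec /\ forall p, R p -> pt (rK p) prec (rr p) (rl p).

Definition D_inf (R : rule -> Prop) (g : 'I_(nD S)) : Prop :=
  ~ exists s : seq rule, forall p, R p -> glab (rK p) (rl p) = Some (inr g) ->
      List.In p s.
Definition in_G_inf (R : rule -> Prop) (p : rule) : Prop :=
  R p /\ exists g, glab (rK p) (rl p) = Some (inr g) /\ D_inf R g.
Definition in_G_fin (R : rule -> Prop) (p : rule) : Prop :=
  R p /\ ~ in_G_inf R p.

Definition inf_rule_conds (d : nat) (p : rule) : Prop :=
  let K := rK p in
  [/\ max_shared (cap_nrm (ksub K (rl p))),
      (forall v, v \in knrm K (rl p) -> glab K v <> None -> closed (ksub K v)),
      size (undup ([seq v <- knrm K (rl p) | glab K v == None] ++
                   flatten [seq tnodes (ksub K v) | v <- ksafe K (rl p)])) <= d &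
      size (tnodes (ksub K (rr p))) <=
        size (tnodes (ksub K (rl p))) +
        size (undup (flatten [seq tnodes (ksub K v) | v <- knrm K (rr p)]))].
End Graphs.

(* Main.v *)
From HB Require Import structures.
From Stdlib Require Import Relations Classical.
From mathcomp Require Import all_boot zify.
Require Import Defs.
Set Implicit Arguments.
Unset Strict Implicit.
Unset Printing Implicit Defensive.

(** A general safe recursive function is given by a finite straight-line program: a list
of functions, each defined from earlier ones.  Every program entry becomes a defined
symbol, and the index in the list is the precedence.  Projections, constructors,
predecessors, conditionals and safe compositions need only finitely many rules.  For an
entry f defined by recursion there is one rule for each ground term t in the recursion
argument: its left-hand side is f applied to the maximally shared graph of t and to
variables, and its right-hand side unfolds the whole recursion at once, with one node
h_c for each distinct subterm of t, so that equal subterms are evaluated only once.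

Safe composition passes only normal arguments to normal positions.  Hence all normal
arguments that occur in a rewrite sequence are nodes of the initial, maximally shared
graph, and therefore the closed patterns of the recursion rules always match.  Every
node keeps its value under rewriting, and a step deletes a node with defined symbol
while it creates only nodes with smaller symbols, so that counting the nodes per symbol
gives a lexicographically decreasing measure. *)

(** The invariant gives values to nodes of arbitrary, partly evaluated graphs, so it holds along
    every rewrite sequence and not only along innermost ones. A rule is sound when evaluating its
    created nodes gives the value of its left root; the result of any maximal sequence is then
    determined by the value of the initial root. Innermost redexes are used only to show that no
    graph with a defined symbol is stuck. The signature depends on the whole program, which grows
    during compilation. Rules are therefore kept in raw form with program indices as labels, and all
    conditions on an entry are stated so as to survive appending further entries. Condition (iv)
    rests on a count. Let t have m distinct subterms. The right-hand side has at most the L pattern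
    nodes and the m created ones. The left-hand side has L + 1 nodes, and the normal arguments of
    the resulting root reach all m subterms except t itself, so L + m = (L + 1) + (m - 1) is
    enough. *)

Lemma cterm_rect' nC (P : cterm nC -> Type) :
  (forall c ts, foldr (fun t A => (P t * A)%type) unit ts -> P (CT c ts)) ->
  forall t, P t.
Proof.
(* The hypotheses on the arguments are collected by [foldr]: membership needs an equality on terms,
   which is itself obtained through this principle. *)
move=> H; fix IH 1 => -[c ts]; apply: H.
by elim: ts => [|t ts IHts] /=; [exact: tt | split; [exact: IH | exact: IHts]].
Defined.

Section CtermCode.
Variable nC : nat.
(** Coding into [GenTree] equips ground terms with decidable equality; the label 0 is a dummy and
    the constructor is stored as the first leaf. *)
Fixpoint ct_code (t : cterm nC) : GenTree.tree 'I_nC :=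
  let: CT c ts := t in GenTree.Node 0 (GenTree.Leaf c :: map ct_code ts).
Fixpoint ct_decode (t : GenTree.tree 'I_nC) : option (cterm nC) :=
  if t is GenTree.Node _ (GenTree.Leaf c :: us)
  then Some (CT c (pmap ct_decode us)) else None.
Lemma ct_codeK : pcancel ct_code ct_decode.
Proof.
elim/cterm_rect' => c ts /= IH; do 2!congr (_ _).
by elim: ts IH => //= t ts IHts [-> /IHts ->].
Qed.
End CtermCode.
HB.instance Definition _ nC := Equality.copy (cterm nC) (pcan_type (@ct_codeK nC)).

(** * Ground terms and their distinct subterms *)

Section Terms.
Variables (nC : nat) (arC : 'I_nC -> nat).
Implicit Types (t u : cterm nC) (ts : seq (cterm nC)).

Lemma cterm_ind_in (P : cterm nC -> Prop) :
  (forall c ts, {in ts, forall t, P t} -> P (CT c ts)) -> forall t, P t.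
Proof.
move=> H; elim/cterm_rect' => c ts IH; apply: H => t.
by elim: ts IH => //= u us IHus [Pu /IHus Pus]; rewrite inE => /predU1P[->|/Pus].
Qed.

Fixpoint csize t : nat := let: CT c ts := t in (sumn (map csize ts)).+1.

Definition chd t : 'I_nC := let: CT c _ := t in c.
Definition cargs t : seq (cterm nC) := let: CT _ ts := t in ts.

Lemma ctE t : t = CT (chd t) (cargs t). Proof. by case: t. Qed.

Lemma csize_arg c ts t : t \in ts -> csize t < csize (CT c ts).
Proof.
move=> /=; elim: ts => //= u us IH; rewrite inE => /predU1P[->|/IH]; lia.
Qed.

Fixpoint subterms t : seq (cterm nC) :=
  let: CT c ts := t in CT c ts :: flatten (map subterms ts).

Lemma subterms_refl t : t \in subterms t.
Proof. by case: t => c ts /=; rewrite mem_head. Qed.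

Lemma subtermsP c ts u :
  reflect (u = CT c ts \/ exists2 t, t \in ts & u \in subterms t)
          (u \in subterms (CT c ts)).
Proof.
rewrite /= inE; apply: (iffP predU1P) => -[->|H]; [by left| |by left|]; right.
  by case/flattenP: H => s /mapP[t tin ->] ?; exists t.
by case: H => t tin ut; apply/flattenP; exists (subterms t) => //; apply: map_f.
Qed.

Lemma subterms_trans t u v : u \in subterms t -> v \in subterms u -> v \in subterms t.
Proof.
elim/cterm_ind_in: t => c ts IH /subtermsP[->//|[t tin ut] vu].
by apply/subtermsP; right; exists t => //; apply: IH.
Qed.

Lemma subterms_arg t c ts u : CT c ts \in subterms t -> u \in ts -> u \in subterms t.
Proof.
move=> /subterms_trans H uin; apply: H; apply/subtermsP; right; exists u => //.
exact: subterms_refl.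
Qed.

Lemma subterms_wf t u : wf_ct arC t -> u \in subterms t -> wf_ct arC u.
Proof.
elim/cterm_ind_in: t => c ts IH wt /subtermsP[->//|[t tin ut]].
by apply: (IH t) => //; move: wt => /= /andP[_ /allP]; apply.
Qed.

(* The distinct subterms of a term are ordered by size, so that arguments come first. *)
Definition subs t := sort (fun a b => csize a <= csize b) (undup (subterms t)).

Lemma mem_subs t u : (u \in subs t) = (u \in subterms t).
Proof. by rewrite mem_sort mem_undup. Qed.

Lemma subs_uniq t : uniq (subs t).
Proof. by rewrite sort_uniq undup_uniq. Qed.

Lemma subs_index_arg t c ts u : CT c ts \in subs t -> u \in ts ->
  index u (subs t) < index (CT c ts) (subs t).
Proof.
move=> tin uin; rewrite ltnNge; apply/negP => le.
have uin' : u \in subs t by move: tin; rewrite !mem_subs => /subterms_arg; apply.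
have st : sorted (fun a b => csize a <= csize b) (subs t).
  by apply: sort_sorted => a b; apply: leq_total.
have trp : transitive (fun a b : cterm nC => csize a <= csize b).
    by move=> x y z; apply: leq_trans.
have := sorted_leq_index trp (fun a => leqnn _) st _ _ tin uin' le.
by rewrite leqNgt csize_arg.
Qed.

Lemma nth_subs_arg t d i u : i < size (subs t) ->
  u \in cargs (nth d (subs t) i) -> (u \in subs t) * (index u (subs t) < i).
Proof.
move=> ilt uin; set v := nth d (subs t) i in uin *.
have vin : v \in subs t by apply: mem_nth.
have vi : index v (subs t) = i by apply: index_uniq => //; apply: subs_uniq.
rewrite -vi (ctE v) in vin *; rewrite (ctE v) in vi *; split.
  by move: vin; rewrite !mem_subs => /subterms_arg; apply.
exact: subs_index_arg.
Qed.

End Terms.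

Section Embed.
Variables (nC : nat) (arC : 'I_nC -> nat) (S : sig arC).

Fixpoint unembed (d : cterm nC) (g : gterm S) : cterm nC :=
  if g is GApp (inl c) gs then CT c (map (unembed d) gs) else d.

Lemma embedK d : cancel (@embed nC arC S) (unembed d).
Proof.
elim/cterm_ind_in => c ts IH /=; congr CT.
rewrite -map_comp -[RHS]map_id; apply/eq_in_map => t tin /=; exact: IH.
Qed.

Lemma embed_inj : injective (@embed nC arC S).
Proof. by move=> t u E; rewrite -[t](embedK t) E embedK. Qed.
End Embed.

(** * Reachability in graphs *)

Section Reachability.
Variable att : nat -> seq nat.
Notation reach := (clos_refl_trans nat (succ att)).

Lemma desc_self n v : v \in desc att n v.
Proof. by case: n => [|n] /=; rewrite ?inE eqxx. Qed.

Lemma desc_reach n v x : x \in desc att n v -> reach v x.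
Proof.
elim: n v => [|n IH] v /=; rewrite ?inE; first by move/eqP->; apply: rt_refl.
case/predU1P=> [->|/flattenP[s /mapP[u uin ->] /IH ?]]; first exact: rt_refl.
by apply: rt_trans (rt_step _ _ _ _ uin) _.
Qed.

Lemma reach_closed (D : nat -> Prop) v u : reach v u -> D v ->
  (forall x y, D x -> y \in att x -> D y) -> D u.
Proof. by move=> r Dv cl; elim: r Dv => //; eauto. Qed.

Lemma reach_cons v u : reach v u -> u = v \/ exists2 y, y \in att v & reach y u.
Proof.
move/clos_rt_rt1n_iff; case=> [|y z vy /clos_rt_rt1n_iff]; first by left.
by right; exists y.
Qed.

Lemma clos_trans_cons v u : clos_trans nat (succ att) v u -> exists2 y, y \in att v & reach y u.
Proof.
elim=> [x y|x y z _ [w wx wy] yz [w' wy' w'z]]; first by exists y => //; apply: rt_refl.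
exists w => //; apply: rt_trans wy _; apply: rt_trans w'z.
by apply: rt_step.
Qed.

Variables (ns : seq nat) (ht : nat -> nat).
Hypothesis ns_closed : forall x, x \in ns -> forall u, u \in att x -> u \in ns /\ ht u < ht x.

(** Since [ht] drops along edges, the size of this list bounds the length of every path leaving [v];
    it is the quantity compared with the fuel of [desc]. *)
Definition lower v := [seq u <- undup ns | ht u < ht v].

Lemma size_lower y v : y \in ns -> ht y < ht v -> size (lower y) < size (lower v).
Proof.
move=> yin lt; have: uniq (y :: lower y).
  by rewrite /= filter_uniq ?undup_uniq // mem_filter ltnn.
move/uniq_leq_size; apply => z; rewrite inE => /predU1P[->|].
  by rewrite mem_filter lt mem_undup.
by rewrite !mem_filter => /andP[/ltn_trans->].
Qed.

Lemma size_lower_lt v : v \in ns -> size (lower v) < size (undup ns).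
Proof.
move=> vin; have: uniq (v :: lower v).
  by rewrite /= filter_uniq ?undup_uniq // mem_filter ltnn.
move/uniq_leq_size; apply => z; rewrite inE => /predU1P[->|]; rewrite ?mem_undup //.
by rewrite mem_filter => /andP[_]; rewrite mem_undup.
Qed.

Lemma desc_closed n v x u : v \in ns -> size (lower v) <= n ->
  x \in desc att n v -> u \in att x -> u \in desc att n v.
Proof.
elim: n v => [|n IH] v vin sz /=.
  rewrite inE => /eqP-> uin; have [uns lt] := ns_closed vin uin.
  by have := size_lower uns lt; lia.
rewrite inE => /predU1P[->|/flattenP[s /mapP[y yin ->] xin]] uin; rewrite inE.
  apply/orP; right; apply/flattenP; exists (desc att n u); first exact: map_f.
  exact: desc_self.
have [yns lt] := ns_closed vin yin.
apply/orP; right; apply/flattenP; exists (desc att n y); first exact: map_f y yin.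
apply: (IH y yns) xin uin; have := size_lower yns lt; lia.
Qed.

Lemma desc_iff n v : v \in ns -> size (undup ns) <= n.+1 ->
  forall x, x \in desc att n v <-> reach v x.
Proof.
move=> vin sz x; split; first exact: desc_reach.
move=> r; apply: (reach_closed (D := fun x => x \in desc att n v) r); first exact: desc_self.
by move=> y z yin zin; apply: (desc_closed vin _ yin zin); have := size_lower_lt vin; lia.
Qed.
End Reachability.

(** * Graphs given as topologically ordered lists *)

Section ListGraphs.
Variables (nC : nat) (arC : 'I_nC -> nat) (S : sig arC).

(** An entry [None] is an unlabeled node; the same default outside the list makes every other number
    unlabeled and without successors. *)
Definition lg (s : seq (option (sym S * seq nat))) : lgraph S :=
  LG (size s) (fun v => omap fst (nth None s v))
     (fun v => if nth None s v is Some (_, a) then a else [::]).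

Definition topological (s : seq (option (sym S * seq nat))) :=
  forall v f a, nth None s v = Some (f, a) -> all (fun u => u < v) a /\ size a = ar f.

Variable s : seq (option (sym S * seq nat)).
Hypothesis s_topo : topological s.
Notation reach := (clos_refl_trans nat (succ (gatt (lg s)))).

Lemma lg_att_lt v u : u \in gatt (lg s) v -> u < v.
Proof.
by rewrite /=; case E: (nth None s v) => [[f a]|//]; have [/allP H _] := s_topo E; apply: H.
Qed.

Lemma lg_reach_le v u : reach v u -> u <= v.
Proof. by move=> r; apply: (reach_closed (D := fun x => x <= v) r) => // x y xv /lg_att_lt; lia. Qed.

Lemma lg_acyclic v : ~ clos_trans nat (succ (gatt (lg s))) v v.
Proof. by case/clos_trans_cons=> y /lg_att_lt + /lg_reach_le; lia. Qed.

Lemma wf_lg : wf_lgraph (lg s).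
Proof.
split=> [v vlt|v|v _]; last exact: lg_acyclic.
  split; first by apply/allP => u /lg_att_lt /ltn_trans; apply.
  by rewrite /=; case E: (nth None s v) => [[f a]|//] /=; have [] := s_topo E.
by move=> ge; rewrite /= nth_default.
Qed.

Lemma ksub_lgP v u : v < size s -> u \in tnodes (ksub (lg s) v) <-> reach v u.
Proof.
move=> vlt; rewrite mem_undup.
apply: (@desc_iff (gatt (lg s)) (iota 0 (size s)) id).
- by move=> x; rewrite mem_iota => /andP[_ xlt] y /lg_att_lt ylt; rewrite mem_iota; lia.
- by rewrite mem_iota.
- by rewrite undup_id ?iota_uniq // size_iota.
Qed.
End ListGraphs.

(** * Programs and their rules *)

Section Programs.
Variables (nC : nat) (arC : 'I_nC -> nat) (c0 : 'I_nC).
Notation d0 := (CT c0 [::]).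

(* Raw form of a rule g(args) -> res. Node indices run through [pre] (constructor
   pattern and variables), then the left root, then [rest] (nodes created by the rule);
   edges point to smaller indices. Numbers in labels are indices of program entries. *)
Record rdata := RD {
  pre : seq (option ('I_nC * seq nat));
  args : seq nat;
  rest : seq (('I_nC + nat) * seq nat);
  res : nat }.

Record entry := Entry { ek : nat; el : nat; ef : fn nC; er : rdata -> Prop }.
Definition entry0 := Entry 0 0 (fun _ _ => d0) (fun _ => False).

Definition psucc (p : seq (option ('I_nC * seq nat))) : relation nat :=
  fun u w => exists c a, nth None p u = Some (c, a) /\ w \in a.
Notation preach p := (clos_refl_trans nat (psucc p)).

Section Prog.
Variable P : seq entry.
Notation ent j := (nth entry0 P j).

Definition arR (s : 'I_nC + nat) : nat :=
  match s with inl c => arC c | inr j => ek (ent j) + el (ent j) end.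

Definition appl (s : 'I_nC + nat) (ts : seq (cterm nC)) : cterm nC :=
  match s with
  | inl c => CT c ts
  | inr j => ef (ent j) (take (ek (ent j)) ts) (drop (ek (ent j)) ts)
  end.

(** Positions in the environment are node indices. The left root occupies one of them, so rules are
    run on the pattern values followed by a dummy [d0]. *)
Definition run (env : seq (cterm nC)) (code : seq (('I_nC + nat) * seq nat)) :=
  foldl (fun env e => rcons env (appl e.1 [seq nth d0 env x | x <- e.2])) env code.

(** No created node points back to the left root. The last clause is the discipline of safe
    composition: normal arguments of a created node lie below normal arguments of the left root. It
    yields both clause (2) of the termination order and the preservation of maximal sharing at
    normal positions. *)
Definition code_ok (i : nat) (rd : rdata) (j : nat) (s : 'I_nC + nat) (a : seq nat) :=
  [/\ size a = arR s,
      all (fun x => (x < (size (pre rd)).+1 + j) && (x != size (pre rd))) a &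
      forall q, s = inr q -> q < i /\
        forall x, x \in take (ek (ent q)) a ->
        exists2 y, y \in take (ek (ent i)) (args rd) & preach (pre rd) y x].

Definition rd_ok (i : nat) (rd : rdata) : Prop :=
  [/\ (forall j c a, nth None (pre rd) j = Some (c, a) ->
         size a = arC c /\ all (fun u => u < j) a),
      size (args rd) = arR (inr i) /\ all (fun x => x < size (pre rd)) (args rd),
      (forall j, j < size (pre rd) -> exists2 x, x \in args rd & preach (pre rd) x j),
      (forall j s a, onth (rest rd) j = Some (s, a) -> code_ok i rd j s a) &
      res rd < (size (pre rd)).+1 + size (rest rd) /\ res rd <> size (pre rd)].

(** Soundness of a rule, tested on every valuation of the pattern nodes that respects the
    constructors of the pattern. *)
Definition sem_ok (i : nat) (rd : rdata) : Prop :=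
  forall vs, size vs = size (pre rd) -> all (wf_ct arC) vs ->
    (forall j c a, nth None (pre rd) j = Some (c, a) ->
       nth d0 vs j = CT c [seq nth d0 vs x | x <- a]) ->
    nth d0 (run (rcons vs d0) (rest rd)) (res rd) =
    appl (inr i) [seq nth d0 vs x | x <- args rd].

(** Completeness of the rules of an entry: some rule matches as soon as all arguments are values.
    [D] stands for the nodes below the redex and [N] for those below normal arguments, where equal
    values mean equal nodes. Labels are bare constructors so that no signature is mentioned. *)
Definition match_ok (e : entry) : Prop :=
  forall (lab : nat -> option 'I_nC) (att : nat -> seq nat) (val : nat -> cterm nC)
         (D N : nat -> Prop) (us : seq nat),
  (forall v, D v -> exists c, [/\ lab v = Some c, size (att v) = arC c,
      (forall u, u \in att v -> D u), val v = CT c (map val (att v)) & wf_ct arC (val v)]) ->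
  (forall v u, D v -> N v -> u \in att v -> N u) ->
  (forall u v, D u -> D v -> N u -> N v -> val u = val v -> u = v) ->
  size us = ek e + el e -> (forall u, u \in us -> D u) ->
  (forall u, u \in take (ek e) us -> N u) ->
  exists rd fs, [/\ er e rd, size fs = size (pre rd), (forall x, x \in fs -> D x),
    (forall j c a, nth None (pre rd) j = Some (c, a) ->
       lab (nth 0 fs j) = Some c /\ att (nth 0 fs j) = [seq nth 0 fs x | x <- a]) &
    us = [seq nth 0 fs x | x <- args rd]].

(* Nodes: the distinct subterms of [t], then the other [k + l] arguments as variables, the
   left root [L], and at [L + 1 + i] the recursive value at the i-th subterm. *)
Definition rec_rd (k l : nat) (hs : 'I_nC -> nat) (t : cterm nC) : rdata :=
  let st := subs t in
  let m := size st in
  let L := m + (k + l) in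
  RD ([seq Some (chd s, [seq index u st | u <- cargs s]) | s <- st] ++ nseq (k + l) None)
     (index t st :: iota m (k + l))
     [seq (inr (hs (chd s)), [seq index u st | u <- cargs s] ++ iota m (k + l) ++
            [seq L.+1 + index u st | u <- cargs s]) | s <- st]
     (L.+1 + index t st).

(** This dichotomy identifies the infinite part of the system: a symbol with infinitely many rules
    must come from a recursion entry. *)
Definition fin_or_rec (e : entry) : Prop :=
  (exists s, forall rd, er e rd -> List.In rd s) \/
  exists hs k l, [/\ ek e = k.+1, el e = l, forall c, ek (ent (hs c)) = arC c + k &
    forall rd, er e rd -> exists2 t, wf_ct arC t & rd = rec_rd k l hs t].

Definition wf_fun (e : entry) : Prop :=
  forall xs ys, inputs arC (ek e) (el e) xs ys -> wf_ct arC (ef e xs ys).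

Definition entry_ok (i : nat) : Prop :=
  [/\ forall rd, er (ent i) rd -> rd_ok i rd /\ sem_ok i rd,
      match_ok (ent i), fin_or_rec (ent i) & wf_fun (ent i)].

Lemma nth_run_lt env code x : x < size env -> nth d0 (run env code) x = nth d0 env x.
Proof.
elim: code env => //= e code IH env lt.
by rewrite IH ?size_rcons ?nth_rcons ?lt //; lia.
Qed.

Lemma nth_run env code j s a : onth code j = Some (s, a) ->
  all (fun x => x < size env + j) a ->
  nth d0 (run env code) (size env + j) = appl s [seq nth d0 (run env code) x | x <- a].
Proof.
elim: code env j => [|e code IH] env [|j] //=.
  case=> -> /allP alt; rewrite addn0 in alt *.
  rewrite nth_run_lt ?size_rcons // nth_rcons ltnn eqxx /=; congr appl.
  apply/eq_in_map => x /alt xlt.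
  by rewrite nth_run_lt ?size_rcons ?nth_rcons ?xlt //; lia.
move=> E alt; rewrite -addSnnS -(size_rcons env (appl e.1 [seq nth d0 env x | x <- e.2])).
by apply: IH => //; rewrite size_rcons addSnnS.
Qed.

End Prog.

(** An entry refers only to earlier ones, so its correctness is required under every continuation
    [Q]; this makes the property stable when a program is extended. *)
Definition program_ok (P : seq entry) :=
  forall i, i < size P -> forall Q, entry_ok (take i.+1 P ++ Q) i.

Section Rules.
Variables (P : seq entry) (P_gt0 : 0 < size P) (P_ok : program_ok P).
Notation ent j := (nth entry0 P j).

Lemma entry_okP i : i < size P -> entry_ok P i.
Proof. by move=> /P_ok/(_ (drop i.+1 P)); rewrite cat_take_drop. Qed.

(** The number of symbols is written as a successor so that [inord] can turn program indices into
    symbols. *)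
Definition psig : sig arC :=
  @Sig nC arC (size P).-1.+1 (fun g => arR P (inr (nat_of_ord g)))
    (fun s i => match s with inl _ => false | inr g => i < ek (ent g) end).

Definition tolab (s : 'I_nC + nat) : sym psig :=
  match s with inl c => inl c | inr j => inr (inord j) end.
Definition unlab (s : sym psig) : 'I_nC + nat :=
  match s with inl c => inl c | inr j => inr (nat_of_ord j) end.

Lemma ord_ltP (g : 'I_(nD psig)) : g < size P.
Proof. by rewrite -(prednK P_gt0). Qed.

Lemma tolabK s : (if s is inr j then j < size P else true) -> unlab (tolab s) = s.
Proof. by case: s => // j jlt /=; rewrite inordK ?prednK. Qed.

Lemma ar_unlab s : ar s = arR P (unlab s). Proof. by case: s. Qed.

Definition pnodes (p : seq (option ('I_nC * seq nat))) : seq (option (sym psig * seq nat)) :=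
  map (omap (fun ca => (inl ca.1, ca.2))) p.
Definition nodes (g : 'I_(nD psig)) (rd : rdata) : seq (option (sym psig * seq nat)) :=
  pnodes (pre rd) ++ Some (inr g, args rd) :: [seq Some (tolab sa.1, sa.2) | sa <- rest rd].

Definition rule_of g rd : rule psig := Rule (lg (nodes g rd)) (size (pre rd)) (res rd).

Definition prules (p : rule psig) : Prop :=
  exists g rd, er (ent (nat_of_ord g)) rd /\ p = rule_of g rd.

Definition prec (a b : sym psig) : Prop :=
  match a, b with
  | inl _, inr _ => True
  | inr x, inr y => (nat_of_ord x < nat_of_ord y)%N
  | _, inl _ => False
  end.

Lemma prec_precedence : precedence prec.
Proof.
split=> [[c|g] //=|[a|a] [b|b] [c|c] //=|[c|g]|c [s|s] //].
- by rewrite ltnn.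
- exact: ltn_trans.
- by constructor=> -[].
have acc0 c' : Acc prec (inl c') by constructor=> -[].
have acc n : forall x : 'I_(nD psig), (x < n)%N -> Acc prec (inr x).
  elim: n => [x|n IH x xn]; first by rewrite ltn0.
  constructor.
  move=> [c _|y yx]; first exact: acc0.
  apply: IH.
  exact: leq_trans yx xn.
exact: (acc _ g (ltnSn g)).
Qed.

(** * A single rule: well-formedness and precedence termination *)

Section OneRule.
Variables (g : 'I_(nD psig)) (rd : rdata).
Hypothesis rdok : rd_ok P g rd.
Notation L := (size (pre rd)).
Notation K := (lg (nodes g rd)).
Notation reach := (clos_refl_trans nat (succ (gatt K))).

Lemma size_nodes : size (nodes g rd) = L.+1 + size (rest rd).
Proof. by rewrite size_cat /= !size_map addSnnS. Qed.

Lemma nth_nodes_pre j : j < L ->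
  nth None (nodes g rd) j = omap (fun ca => (inl ca.1, ca.2)) (nth None (pre rd) j).
Proof. by move=> jlt; rewrite nth_cat size_map jlt (nth_map None). Qed.

Lemma nth_nodes_root : nth None (nodes g rd) L = Some (inr g, args rd).
Proof. by rewrite nth_cat size_map ltnn subnn. Qed.

Lemma nth_nodes_rest j :
  nth None (nodes g rd) (L.+1 + j) = omap (fun sa => (tolab sa.1, sa.2)) (onth (rest rd) j).
Proof.
rewrite nth_cat size_map ltnNge ltnW ?leq_addr //= subSn ?leq_addr //= addKn.
by elim: (rest rd) j => [|sa c IH] [|j] //=; rewrite IH.
Qed.

Lemma code_at j : j < size (rest rd) -> exists s a,
  [/\ onth (rest rd) j = Some (s, a), code_ok P g rd j s a &
      unlab (tolab s) = s].
Proof.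
move=> jlt; case: rdok => _ _ _ rok _.
case E: (onth (rest rd) j) => [[s a]|]; last first.
  by have := onthTE (rest rd) j; rewrite E jlt.
exists s, a; split=> //; first exact: rok.
apply: tolabK; case: s E => // q /rok[_ _ /(_ q erefl)[qlt _]].
exact: ltn_trans qlt (ord_ltP g).
Qed.

Lemma nodes_topo : topological (nodes g rd).
Proof.
case: rdok => pok [asz aok] _ _ _ v f a.
case: (ltngtP v L) => vL; first 1 last.
- have -> : v = L.+1 + (v - L.+1) by lia.
  rewrite nth_nodes_rest; case: (ltnP (v - L.+1) (size (rest rd))) => jlt; last first.
    by rewrite onth_default.
  have [s [b [-> [bsz /allP bok _] us]]] := code_at jlt; case=> <- <-.
  by rewrite ar_unlab us; split=> //; apply/allP => x /bok/andP[].
- rewrite vL nth_nodes_root; case=> <- <-; split=> //.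
rewrite nth_nodes_pre //; case E: (nth None (pre rd) v) => [[c b]|] //= [<- <-].
by have [] := pok _ _ _ E.
Qed.

Lemma preach_reach x y : x < L -> preach (pre rd) x y -> reach x y /\ y < L.
Proof.
move=> + r; elim: r => {x y} [x y [c [a [E yin]]] xlt|x xlt|x y z _ IH1 _ IH2 xlt].
- split; first by apply: rt_step; rewrite /succ /= nth_nodes_pre // E.
  by case: rdok => /(_ _ _ _ E)[_ /allP/(_ _ yin)]; lia.
- by split=> //; apply: rt_refl.
have [xy /IH2[yz zlt]] := IH1 xlt; split=> //; exact: rt_trans yz.
Qed.

Lemma gatt_root : gatt K L = args rd.
Proof. by rewrite /= nth_nodes_root. Qed.

Lemma glab_root : glab K L = Some (inr g).
Proof. by rewrite /= nth_nodes_root. Qed.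

Lemma args_lt x : x \in args rd -> x < L.
Proof. by case: rdok => _ [_ /allP H] _ _ _; apply: H. Qed.

Lemma reach_root x : x <= L -> reach L x.
Proof.
rewrite leq_eqVlt => /predU1P[->|xlt]; first exact: rt_refl.
case: rdok => _ _ /(_ x xlt)[y yin yx] _ _.
have [r _] := preach_reach (args_lt yin) yx; apply: rt_trans r.
by apply: rt_step; rewrite /succ gatt_root.
Qed.

Lemma root_lt : L < size (nodes g rd).
Proof. by rewrite size_nodes; lia. Qed.

Lemma ksub_root x : (x \in tnodes (ksub K L)) = (x <= L).
Proof.
apply/idP/idP => [/(ksub_lgP nodes_topo _ root_lt)/(lg_reach_le nodes_topo)//|xL].
exact/(ksub_lgP nodes_topo _ root_lt)/reach_root.
Qed.

Lemma pre_con x : x < L -> glab K x = None \/ is_con (glab K x).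
Proof.
by move=> xlt; rewrite /= nth_nodes_pre //; case: (nth None (pre rd) x); [right|left].
Qed.

Lemma rest_labelled x : L < x -> x < size (nodes g rd) -> exists s a,
  [/\ glab K x = Some (tolab s), gatt K x = a, code_ok P g rd (x - L.+1) s a &
      unlab (tolab s) = s].
Proof.
move=> Lx; rewrite size_nodes => xlt.
have jlt : x - L.+1 < size (rest rd) by lia.
have [s [a [E ok us]]] := code_at jlt; exists s, a.
have xE : L.+1 + (x - L.+1) = x by lia.
by split=> //; rewrite /= -xE nth_nodes_rest E.
Qed.

Lemma res_lt : res rd < size (nodes g rd).
Proof. by rewrite size_nodes; case: rdok => _ _ _ _ []. Qed.

Lemma res_neq : res rd <> L.
Proof. by case: rdok => _ _ _ _ []. Qed.

(** The pattern and its arguments point below [L], and [code_ok] excludes [L] for created nodes.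
    Consequently the left root cannot be reached from the result, which is distinct from it. *)
Lemma gatt_neq x y : y \in gatt K x -> y <> L \/ x = L.
Proof.
move=> yin; case: (ltngtP x L) => xL; [left|left|by right].
  by have := lg_att_lt nodes_topo yin; lia.
have xlt : x < size (nodes g rd).
  by rewrite ltnNge; apply: contraL yin => /= ge; rewrite nth_default.
have [s [a [_ aE [_ /allP aok _] _]]] := rest_labelled xL xlt.
by move: yin; rewrite aE => /aok/andP[_ /eqP].
Qed.

Lemma reach_res_neq x : reach (res rd) x -> x <> L.
Proof.
move=> r; apply: (reach_closed (D := fun x => x <> L) r); first exact: res_neq.
by move=> y z yL /gatt_neq[].
Qed.

Lemma rule_of_wf : wf_rule (rule_of g rd).
Proof.
split=> /=; [exact: wf_lg nodes_topo|exact: root_lt|exact: res_lt|by move/esym/res_neq|].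
move=> u /(ksub_lgP nodes_topo _ res_lt) ru E; rewrite ksub_root leqNgt.
apply/negP => /rest_labelled H; case: H => [|s [a [/= F]]]; last by rewrite E in F.
exact: leq_ltn_trans (lg_reach_le nodes_topo ru) res_lt.
Qed.

Lemma rule_of_constructor : constructor_rule (rule_of g rd).
Proof.
split; first by exists g; apply: glab_root.
rewrite [rl _]/= [rK _]/= gatt_root => v /args_lt vlt u.
move/(ksub_lgP nodes_topo _ (ltn_trans vlt root_lt))/(lg_reach_le nodes_topo) => uv.
by apply: pre_con; lia.
Qed.

Lemma lab_below_root x : reach (res rd) x -> lab_below K prec x L.
Proof.
move=> rx v f' vin vlab; exists (inr g); split; first exact: glab_root.
have xlt := leq_ltn_trans (lg_reach_le nodes_topo rx) res_lt.
move/(ksub_lgP nodes_topo _ xlt): vin => xv.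
have vL : v <> L by apply: reach_res_neq; apply: rt_trans xv.
case: (ltngtP v L) => // vL'; first by case: (pre_con vL'); rewrite vlab //; case: f' {vlab}.
have vlt := leq_ltn_trans (lg_reach_le nodes_topo xv) xlt.
have [s [a [sE _ [_ _ ok] us]]] := rest_labelled vL' vlt.
move: sE; rewrite vlab => -[->]; case: s ok us => //= q /(_ q erefl)[qg _] [->].
exact: qg.
Qed.

Lemma nrm_of_con (lab : nat -> option (sym psig)) att x : is_con (lab x) -> nrm_of lab att x = [::].
Proof.
by rewrite /nrm_of; case: (lab x) => [[c|//]|//] _ /=; elim: (iota _ _).
Qed.

Lemma nrm_ofE (lab : nat -> option (sym psig)) att x q : lab x = Some (inr q) -> nrm_of lab att x = take (ek (ent q)) (att x).
Proof.
rewrite /nrm_of => -> /=.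
transitivity [seq nth 0 (att x) i | i <- iota 0 (minn (ek (ent q)) (size (att x)))].
  congr map; rewrite -[size (att x)](@subnKC (minn (ek (ent q)) (size (att x)))) ?geq_minr //.
  set a := minn _ _; rewrite iotaD filter_cat add0n.
  rewrite (@eq_in_filter _ _ predT) ?filter_predT; last first.
    by move=> i; rewrite mem_iota /a /=; lia.
  rewrite (@eq_in_filter _ _ pred0) ?filter_pred0 ?cats0; last first.
    by move=> i; rewrite mem_iota /a /=; lia.
  by rewrite subnKC ?geq_minr // /a; congr iota; lia.
apply: (@eq_from_nth _ 0) => [|i]; rewrite size_map size_iota ?size_take_min //.
move=> ilt; rewrite (nth_map 0) ?size_iota // nth_iota // nth_take //.
by move: ilt; rewrite leq_min => /andP[].
Qed.

(** Induction over the nodes reachable from the result. Variables fall under clause (1); pattern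
    constructors, having only safe positions, and created nodes fall under clause (2). *)
Lemma pt_rule : pt K prec (res rd) L.
Proof.
suff H x : reach (res rd) x -> pt K prec x L by apply: H; apply: rt_refl.
elim/ltn_ind: x => x IH rx.
have xlt := leq_ltn_trans (lg_reach_le nodes_topo rx) res_lt.
have safeP v : v \in ksafe K x -> pt K prec v L.
  rewrite /ksafe /safe_of; case E: (glab K x) => [f|//] /mapP[i].
  rewrite mem_filter mem_iota => /andP[_ /andP[_ ilt]] ->.
  have ain : nth 0 (gatt K x) i \in gatt K x by apply: mem_nth.
  apply: IH; first exact: lg_att_lt nodes_topo _ _ ain.
  by apply: rt_trans rx _; apply: rt_step.
case: (ltngtP x L) => xL; last by have := reach_res_neq rx.
  case: (pre_con xL) => [xN|xcon]; last first.
    apply: pt_arg => //; [exact: lab_below_root|by case: (glab K x) xcon|].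
    by move=> v; rewrite /knrm nrm_of_con.
  (* A variable has no successors, so the condition on labels is vacuous against any node; clause
     (1) can then be iterated along a path from the left root. *)
  have lb y : lab_below K prec x y.
    move=> v f' /(ksub_lgP nodes_topo _ xlt) /reach_cons[->|[w + _]]; first by rewrite xN.
    by move: xN; rewrite /=; case: (nth None _ x).
  have [y yin ryx] : exists2 y, y \in gatt K L & reach y x.
    by case/reach_cons: (reach_root (ltnW xL)) => [/eqP|//]; rewrite ltn_eqF.
  apply: (pt_sub (u := y)) => //.
  elim/clos_refl_trans_ind_right: ryx {yin} => [|u u' uu' IHu _]; first by left.
  by right; apply: (pt_sub (u := u')).
have [s [a [sE aE [asz /allP alt aok] us]]] := rest_labelled xL xlt.
apply: pt_arg => //; [exact: lab_below_root|by rewrite sE|].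
move=> v; case: s sE aok us asz => [c|q] sE aok us asz.
  by rewrite /knrm nrm_of_con // sE.
have [qg nok] := aok q erefl.
rewrite /knrm (nrm_ofE _ sE) aE (nrm_ofE _ glab_root) gatt_root.
have -> : (inord q : 'I_(nD psig)) = q :> nat by case: us.
move=> /nok[y yin yv]; exists y; split=> //.
have ylt : y < L by apply: args_lt; apply: mem_take yin.
by apply/(ksub_lgP nodes_topo _ (ltn_trans ylt root_lt)); case: (preach_reach ylt yv).
Qed.

End OneRule.
End Rules.
End Programs.

(** * The invariant of rewriting *)

Section Semantics.
Variables (nC : nat) (arC : 'I_nC -> nat) (c0 : 'I_nC).
Notation d0 := (CT c0 [::]).
Variables (P : seq (entry nC)) (P_gt0 : 0 < size P) (P_ok : program_ok arC c0 P).
Notation ent j := (nth (entry0 c0) P j).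
Notation S := (psig arC c0 P).

Lemma appl_wf (s : sym S) ts : size ts = ar s -> all (wf_ct arC) ts ->
  wf_ct arC (appl c0 P (unlab s) ts).
Proof.
case: s => [c|q] sz wts /=; first by rewrite sz eqxx.
have [_ _ _] := entry_okP P_ok (ord_ltP P_gt0 q); apply.
move: sz; rewrite /= => sz.
split; rewrite ?size_drop ?size_takel ?sz ?leq_addr ?addKn //.
  by apply/allP => t /mem_take; apply/allP.
by apply/allP => t /mem_drop; apply/allP.
Qed.

(* [val] assigns its value to every node and [ht] is a rank witnessing acyclicity;
   [N] contains the nodes below normal arguments: these are constructor nodes,
   never redirected, and maximally shared. *)
Record good (lab : nat -> option (sym S)) (att : nat -> seq nat) (D : seq nat)
    (val : nat -> cterm nC) (ht : nat -> nat) (N : nat -> Prop) : Prop := Good {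
  good_node : forall v, v \in D -> exists s,
    [/\ lab v = Some s, size (att v) = ar s, (forall u, u \in att v -> u \in D),
        val v = appl c0 P (unlab s) (map val (att v)) &
        forall u, u \in att v -> ht u < ht v];
  good_wf : forall v, v \in D -> wf_ct arC (val v);
  good_nrm : forall v q, v \in D -> lab v = Some (inr q) ->
    forall u, u \in take (ek (ent (nat_of_ord q))) (att v) -> N u;
  good_N : forall v, v \in D -> N v -> is_con (lab v) /\ forall u, u \in att v -> N u;
  good_inj : forall u v, u \in D -> v \in D -> N u -> N v -> val u = val v -> u = v }.

Definition invariant (t : cterm nC) (G : tgraph S) : Prop :=
  troot G \in tnodes G /\ exists val ht N,
    good (tlab G) (tatt G) (tnodes G) val ht N /\ val (troot G) = t.

(** Garbage collection restricts a graph to a set closed under successors, and all clauses of [good]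
    survive such a restriction. *)
Lemma good_sub lab att lab' att' D D' val ht N : good lab att D val ht N ->
  {subset D' <= D} -> (forall v, v \in D' -> lab' v = lab v /\ att' v = att v) ->
  (forall v u, v \in D' -> u \in att' v -> u \in D') ->
  good lab' att' D' val ht N.
Proof.
case=> nodeP wfP nrmP NP injP sub eqP clP; split.
- move=> v vin; have [s [? ? ? ? ?]] := nodeP v (sub v vin); exists s.
  by have [-> E] := eqP v vin; rewrite E; split=> // u; rewrite -E; apply: clP.
- by move=> v /sub /wfP.
- by move=> v q vin; have [-> ->] := eqP v vin; apply/nrmP/sub.
- by move=> v vin; have [-> ->] := eqP v vin; apply/NP/sub.
- by move=> u v /sub uin /sub vin; apply: injP.
Qed.

Lemma invariant_eq t G H : tg_eq H G -> invariant t G -> invariant t H.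
Proof.
case=> rE nE lE [rin [val [ht [N [gd vE]]]]]; split; first by rewrite rE nE.
exists val, ht, N; split; last by rewrite rE.
apply: good_sub (gd) _ (lE) _ => [v|v u vin]; first by rewrite nE.
have [_ ->] := lE v vin; rewrite !nE in vin *.
by have [s [_ _ H' _ _]] := good_node gd vin; apply: H'.
Qed.

(** * Preservation of the invariant by one rewrite step *)

Section Step.
Variable G : tgraph S.
Variables (val : nat -> cterm nC) (ht : nat -> nat) (N : nat -> Prop).
Hypothesis Ggood : good (tlab G) (tatt G) (tnodes G) val ht N.
Variables (g : 'I_(nD S)) (rd : rdata nC).
Hypothesis erd : er (ent (nat_of_ord g)) rd.
Notation L := (size (pre rd)).
Notation K := (lg (nodes g rd)).
Notation p := (rule_of g rd).
Notation reach := (clos_refl_trans nat (succ (gatt K))).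
Variables (phi psi : nat -> nat).
Hypothesis phi_hom : homom (ksub K L) G phi.
Hypothesis psi_fresh : forall u, u \in new_nodes p -> psi u \notin tnodes G.
Hypothesis psi_inj : {in new_nodes p &, injective psi}.

(** These repeat the local definitions inside [rw_result], so that its labels and successors are
    convertible to [lab1] and [att2]. Only [D2] is new: the nodes before garbage collection, with
    the redex already removed. *)
Let nn := new_nodes p.
Let chi u := if u \in tnodes (ksub K L) then phi u else psi u.
Let w := phi L.
Let r' := chi (res rd).
Let red x := if x == w then r' else x.
Let idx x := find (fun u => psi u == x) nn.
Let lab1 x := if idx x < size nn then glab K (nth 0 nn (idx x)) else tlab G x.
Let att2 x := [seq red y | y <- if idx x < size nn
  then [seq chi z | z <- gatt K (nth 0 nn (idx x))] else tatt G x].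
Let D2 := [seq x <- tnodes G | x != w] ++ map psi nn.

Let rdok : rd_ok arC c0 P g rd.
Proof. by have [/(_ rd erd)[]] := entry_okP P_ok (ord_ltP P_gt0 g). Qed.

Let topo := nodes_topo P_gt0 rdok.

Let phi_node u : u <= L -> phi u \in tnodes G.
Proof. by move=> uL; have [] := phi_hom (u := u); rewrite // (ksub_root P_gt0 rdok). Qed.

Let phi_lab u f : u <= L -> glab K u = Some f ->
  tlab G (phi u) = Some f /\ tatt G (phi u) = map phi (gatt K u).
Proof. by move=> uL E; have [|_] := phi_hom (u := u); rewrite ?(ksub_root P_gt0 rdok) //; apply. Qed.

Let w_in : w \in tnodes G. Proof. exact: phi_node. Qed.

Let w_lab : tlab G w = Some (inr g) /\ tatt G w = map phi (args rd).
Proof. by have := phi_lab (leqnn L) (glab_root g rd); rewrite gatt_root. Qed.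

Let phi_att x y : x <= L -> y \in gatt K x -> phi y \in tatt G (phi x) /\ y < L.
Proof.
move=> xL yin; have yx := lg_att_lt topo yin; split; last exact: leq_trans yx xL.
have [f E] : exists f, glab K x = Some f.
  by move: yin; rewrite /=; case: (nth None _ x) => [[f a]|//]; exists f.
by have [_ ->] := phi_lab xL E; apply: map_f.
Qed.

(** Every pattern node is reachable from the left root and [phi] maps edges to edges, along which
    [ht] drops. As [phi] need not be injective, this is what keeps the images of pattern nodes off
    the redex. *)
Let ht_phi u : u < L -> ht (phi u) < ht w.
Proof.
move=> uL; have /reach_cons := reach_root P_gt0 rdok (ltnW uL).
case=> [/eqP|[y yin yu]]; first by rewrite ltn_eqF.
suff []: u < L /\ ht (phi u) < ht w by [].
apply: (reach_closed (D := fun u => u < L /\ ht (phi u) < ht w) yu).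
  have [] := phi_att (leqnn L) yin; split=> //.
  by have [s [_ _ _ _]] := good_node Ggood w_in; apply.
move=> a b [aL aw] /(phi_att (ltnW aL))[bin bL]; split=> //.
have [s [_ _ _ _ /(_ _ bin)]] := good_node Ggood (phi_node (ltnW aL)).
by move/ltn_trans; apply.
Qed.

Let phi_neq u : u < L -> phi u <> w.
Proof. by move=> /ht_phi lt E; rewrite E ltnn in lt. Qed.

Let N_neq x : x \in tnodes G -> N x -> x <> w.
Proof. by move=> xin /(good_N Ggood xin)[+ _] E; rewrite E w_lab.1. Qed.

Let red_N x : x \in tnodes G -> N x -> red x = x.
Proof. by move=> xin /(N_neq xin)/eqP/negbTE; rewrite /red => ->. Qed.

Let N_phi x y : y \in take (ek (ent (nat_of_ord g))) (args rd) -> reach y x -> N (phi x).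
Proof.
move=> yin r; suff []: x < L /\ N (phi x) by [].
apply: (reach_closed (D := fun x => x < L /\ N (phi x)) r).
  split; first by apply: (args_lt rdok); apply: mem_take yin.
  apply: (good_nrm Ggood w_in w_lab.1); rewrite w_lab.2 -map_take; exact: map_f.
move=> a b [aL aN] /(phi_att (ltnW aL))[bin bL]; split=> //.
by have [_] := good_N Ggood (phi_node (ltnW aL)) aN; apply.
Qed.

Let vs := [seq val (phi u) | u <- iota 0 L].
Let env := run c0 P (rcons vs d0) (rest rd).

Let size_vs : size vs = L. Proof. by rewrite size_map size_iota. Qed.

Let nth_vs u : u < L -> nth d0 vs u = val (phi u).
Proof. by move=> uL; rewrite (nth_map 0) ?size_iota // nth_iota. Qed.

Let env_lt u : u < L -> nth d0 env u = val (phi u).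
Proof.
by move=> uL; rewrite nth_run_lt ?size_rcons ?nth_rcons size_vs ?uL ?nth_vs //; lia.
Qed.

(** [sem_ok] at the values of the matched nodes: the result has the value of the redex, hence
    redirecting edges to it changes no value. *)
Let env_res : nth d0 env (res rd) = val w.
Proof.
have [/(_ rd erd)[_ sem] _ _ _] := entry_okP P_ok (ord_ltP P_gt0 g).
rewrite sem ?size_vs //.
- have [s [sE _ _ -> _]] := good_node Ggood w_in.
  move: sE; rewrite w_lab.1 => -[<-]; rewrite w_lab.2 -map_comp; congr appl.
  by apply/eq_in_map => x /(args_lt rdok)/nth_vs.
- apply/allP => x /mapP[u + ->]; rewrite mem_iota => /andP[_ uL].
  by apply: (good_wf Ggood); apply/phi_node/ltnW.
move=> j c a E; have jL : j < L.
  by rewrite ltnNge; apply/negP => ge; rewrite nth_default in E.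
rewrite nth_vs //.
have Ej : nth None (nodes g rd) j = Some (inl c, a) by rewrite nth_nodes_pre // E.
have [lE aE] : tlab G (phi j) = Some (inl c) /\ tatt G (phi j) = map phi a.
  by have := phi_lab (u := j) (f := inl c) (ltnW jL); rewrite /= Ej; apply.
have [s [sE _ _ -> _]] := good_node Ggood (phi_node (ltnW jL)).
move: sE; rewrite lE => -[<-] /=; rewrite aE -map_comp; congr CT.
apply/eq_in_map => x xin /=; rewrite nth_vs //.
by case: rdok => /(_ _ _ _ E)[_ /allP/(_ x xin)]; lia.
Qed.

Let env_rest z : L < z -> z < size (nodes g rd) -> exists s,
  [/\ glab K z = Some s, size (gatt K z) = ar s,
      nth d0 env z = appl c0 P (unlab s) [seq nth d0 env x | x <- gatt K z] &
      code_ok arC c0 P g rd (z - L.+1) (unlab s) (gatt K z)].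
Proof.
move=> Lz zlt; have [s [a [lE aE cok us]]] := rest_labelled P_gt0 rdok Lz zlt.
have [asz /allP alt _] := cok.
exists (tolab arC c0 P s); rewrite lE aE ar_unlab us; split=> //.
have zE : z = size (rcons vs d0) + (z - L.+1) by rewrite size_rcons size_vs; lia.
rewrite zE; apply: nth_run; last first.
  by apply/allP => x /alt /andP[]; rewrite size_rcons size_vs => ->.
have jlt : z - L.+1 < size (rest rd) by move: zlt; rewrite size_nodes; lia.
have [s' [a' [E _ us']]] := code_at P_gt0 rdok jlt.
have Ez : nth None (nodes g rd) z = Some (tolab arC c0 P s', a').
  have -> : z = L.+1 + (z - L.+1) by lia.
  by rewrite nth_nodes_rest E.
move: lE aE; rewrite /= Ez => -[] e1 <-; rewrite E -us' -[in RHS]us; congr (Some (_, _)).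
by rewrite e1.
Qed.

Let env_wf z : z < size (nodes g rd) -> z <> L -> wf_ct arC (nth d0 env z).
Proof.
elim/ltn_ind: z => z IH zlt zL; case: (ltngtP z L) => // zL'.
  by rewrite env_lt //; apply/(good_wf Ggood)/phi_node/ltnW.
have [s [_ sz -> [_ /allP aok _]]] := env_rest zL' zlt.
apply: appl_wf; first by rewrite size_map.
apply/allP => _ /mapP[x xin ->]; have xz := lg_att_lt topo xin.
by apply: IH => //; [exact: ltn_trans xz zlt | case/andP: (aok x xin) => _ /eqP].
Qed.

Let mem_nn z : z \in nn -> [/\ L < z, z < size (nodes g rd) & reach (res rd) z].
Proof.
rewrite mem_filter (ksub_root P_gt0 rdok) -ltnNge => /andP[Lz].
move/(ksub_lgP topo _ (res_lt rdok)) => r; split=> //.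
exact: leq_ltn_trans (lg_reach_le topo r) (res_lt rdok).
Qed.

Let nn_mem z : L < z -> reach (res rd) z -> z \in nn.
Proof.
move=> Lz r; rewrite mem_filter (ksub_root P_gt0 rdok) -ltnNge Lz.
exact/(ksub_lgP topo _ (res_lt rdok)).
Qed.

Let idx_old x : x \in tnodes G -> (idx x < size nn) = false.
Proof.
move=> xin; rewrite /idx -has_find; apply/negP => /hasP[u /psi_fresh + /eqP E].
by rewrite E xin.
Qed.

Let idx_new z : z \in nn -> (idx (psi z) < size nn) /\ nth 0 nn (idx (psi z)) = z.
Proof.
move=> zin; have hs : has (fun u => psi u == psi z) nn by apply/hasP; exists z.
have lt : idx (psi z) < size nn by rewrite /idx -has_find.
split=> //; apply: psi_inj => //; first exact: mem_nth.
by apply/eqP; apply: (nth_find 0 hs).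
Qed.

Let chiE u : reach (res rd) u -> (u < L /\ chi u = phi u) \/ (u \in nn /\ chi u = psi u).
Proof.
move=> r; rewrite /chi (ksub_root P_gt0 rdok); case: (ltngtP u L) => uL.
- by left.
- by right; split=> //; apply: nn_mem.
- by have := reach_res_neq P_gt0 rdok r.
Qed.

(* The created nodes are ranked between the redex and its proper descendants. *)
Let B := size (nodes g rd).
Let val' x := if idx x < size nn then nth d0 env (nth 0 nn (idx x)) else val x.
Let ht' x := if idx x < size nn then ht w * B + nth 0 nn (idx x) else ht x * B + B.
(** Intersecting with the old nodes excludes created ones, whose numbers might happen to satisfy
    [N]. *)
Let N' x := N x /\ x \in tnodes G.

Let psi_neq u : u \in nn -> psi u <> w.
Proof. by move=> /psi_fresh + E; rewrite E w_in. Qed.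

Let in_D2 x : (x \in D2) = (x \in tnodes G) && (x != w) || (x \in map psi nn).
Proof. by rewrite mem_cat mem_filter andbC. Qed.

Let chi_props u : reach (res rd) u ->
  [/\ chi u \in D2, chi u <> w, val' (chi u) = nth d0 env u,
      ht' (chi u) < ht w * B + B &
      forall z, u < z -> ht' (chi u) < ht w * B + z].
Proof.
move=> r; have uB : u < B := leq_ltn_trans (lg_reach_le topo r) (res_lt rdok).
case: (chiE r) => -[uin ->].
  have pin := phi_node (ltnW uin); have nw := phi_neq uin.
  rewrite in_D2 pin /val' /ht' (idx_old pin) (introF eqP nw) env_lt //.
  have := leq_mul (ht_phi uin) (leqnn B); rewrite mulSn.
  by split=> // [|z uz]; lia.
have [il ie] := idx_new uin.
rewrite in_D2 map_f // orbT /val' /ht' il ie; split=> //; first exact: psi_neq.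
  by lia.
by move=> z; lia.
Qed.

(** The rank bound is chosen to cover both cases: an edge left alone ends at rank [ht y * B + B],
    and a redirected one ends strictly below that. *)
Let red_props y : y \in tnodes G ->
  [/\ red y \in D2, val' (red y) = val y & ht' (red y) < (ht y).+1 * B + 1].
Proof.
move=> yin; rewrite /red; case: eqP => [->|/eqP yw].
  have [? ? vE lt _] := chi_props (rt_refl _ _ _).
  by rewrite /r' vE env_res mulSn; split=> //; lia.
rewrite in_D2 yin yw /val' /ht' (idx_old yin) mulSn; split=> //; lia.
Qed.

Let att2_old v : v \in tnodes G -> att2 v = map red (tatt G v).
Proof. by move=> vin; rewrite /att2 idx_old. Qed.

Let red_chi u : reach (res rd) u -> red (chi u) = chi u.
Proof. by case/chi_props => _ /eqP/negbTE; rewrite /red => ->. Qed.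

Let nn_succ z u : z \in nn -> u \in gatt K z -> reach (res rd) u.
Proof. by case/mem_nn => _ _ r uin; apply: rt_trans r _; apply: rt_step. Qed.

Let att2_new z : z \in nn -> att2 (psi z) = map chi (gatt K z).
Proof.
move=> zin; have [il ie] := idx_new zin; rewrite /att2 il ie -map_comp.
by apply/eq_in_map => u uin /=; apply/red_chi/(nn_succ zin uin).
Qed.

Let D2_cases x : x \in D2 ->
  (x \in tnodes G /\ x <> w) \/ exists2 z, z \in nn & x = psi z.
Proof.
rewrite in_D2 => /orP[/andP[xin /eqP xw]|/mapP[z zin ->]]; first by left.
by right; exists z.
Qed.

Let lab1_old v : v \in tnodes G -> lab1 v = tlab G v.
Proof. by move=> vin; rewrite /lab1 idx_old. Qed.

Let lab1_new z : z \in nn -> lab1 (psi z) = glab K z.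
Proof. by move=> zin; have [il ie] := idx_new zin; rewrite /lab1 il ie. Qed.

Lemma step_good : good lab1 att2 D2 val' ht' N'.
Proof.
split.
- move=> v /D2_cases[[vin vw]|[z zin ->]].
    have [s [sE sz aD vE hlt]] := good_node Ggood vin.
    exists s; rewrite lab1_old // att2_old // size_map; split=> //.
    + by move=> _ /mapP[y /aD yin ->]; have [] := red_props yin.
    + rewrite {1}/val' idx_old // vE -map_comp; congr appl; apply/eq_in_map => y /aD yin.
      by have [_ /= ->] := red_props yin.
    + move=> _ /mapP[y yin ->]; have [_ _ lt] := red_props (aD y yin).
      apply: leq_trans lt _; rewrite {1}/ht' idx_old //.
      have B_gt0 : 0 < B by rewrite /B size_nodes.
      by have := leq_mul (hlt y yin) (leqnn B); lia.
  have [Lz zlt _] := mem_nn zin; have [il ie] := idx_new zin.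
  have [s [sE sz vE _]] := env_rest Lz zlt.
  exists s; rewrite lab1_new // att2_new // size_map; split=> //.
  + by move=> _ /mapP[y /(nn_succ zin)/chi_props[? _ _ _ _] ->].
  + rewrite {1}/val' il ie vE -map_comp; congr appl; apply/eq_in_map => y.
    by move=> /(nn_succ zin)/chi_props[_ _ /= -> _ _].
  + move=> _ /mapP[y yin ->]; rewrite {2}/ht' il ie.
    have [_ _ _ _] := chi_props (nn_succ zin yin); apply.
    exact: lg_att_lt topo _ _ yin.
- move=> v /D2_cases[[vin vw]|[z zin ->]].
    by rewrite /val' idx_old //; apply: (good_wf Ggood).
  have [Lz zlt _] := mem_nn zin; have [il ie] := idx_new zin.
  by rewrite /val' il ie; apply: env_wf => //; lia.
(* Normal arguments of an old node are in [N], hence constructors, hence never the redex, so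
   redirection leaves them in place. Those of a created node are images of nodes below normal
   arguments of the left root. *)
- move=> v q /D2_cases[[vin vw]|[z zin ->]].
    rewrite lab1_old // att2_old // -map_take => lE _ /mapP[y yin ->].
    have Ny := good_nrm Ggood vin lE yin.
    have yG : y \in tnodes G.
      have [s [_ _ aD _ _]] := good_node Ggood vin.
      by apply: aD; apply: mem_take yin.
    by rewrite red_N.
  have [Lz zlt _] := mem_nn zin.
  have [s [sE _ _ [_ _ cok]]] := env_rest Lz zlt.
  rewrite lab1_new // sE att2_new // => -[{}sE]; move: cok; rewrite sE /=.
  case/(_ q erefl) => qg nok u; rewrite -map_take => /mapP[x xin ->].
  have [y yin yx] := nok x xin.
  have yL : y < L by apply: (args_lt rdok); apply: mem_take yin.
  have [ryx xL] := preach_reach P_gt0 rdok yL yx.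
  have -> : chi x = phi x by rewrite /chi (ksub_root P_gt0 rdok) ltnW.
  by split; [exact: N_phi yin ryx | exact/phi_node/ltnW].
- move=> v /D2_cases[[vin vw]|[z zin ->]] [Nv vG]; last first.
    by have := psi_fresh zin; rewrite vG.
  have [lc aN] := good_N Ggood vin Nv.
  rewrite lab1_old // att2_old //; split=> // _ /mapP[y yin ->].
  have yG : y \in tnodes G by have [s [_ _ aD _ _]] := good_node Ggood vin; apply: aD.
  by have Ny := aN y yin; rewrite red_N.
- move=> u v _ _ [Nu uG] [Nv vG]; rewrite /val' !idx_old //; exact: good_inj Ggood _ _ _ _ _ _.
Qed.

Hypothesis root_in : troot G \in tnodes G.

Let H := rw_result G p phi psi.

(** [D2] contains the new root and is closed under [att2]. The fuel in [rw_result] is at least the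
    size of [D2], so collection stops only at a set closed under successors. *)
Lemma rw_nodes : {subset tnodes H <= D2} /\
  (forall v u, v \in tnodes H -> u \in att2 v -> u \in tnodes H).
Proof.
have [rD _ _] := red_props root_in.
have Dcl x : x \in D2 -> forall u, u \in att2 x -> u \in D2 /\ ht' u < ht' x.
  move=> xin u uin; have [s [_ _ aD _ hlt]] := good_node step_good xin.
  by split; [apply: aD | apply: hlt].
have HE x : (x \in tnodes H) = (x \in desc att2 (size (tnodes G) + size nn) (red (troot G))).
  by rewrite mem_undup.
split=> [x|v u]; rewrite !HE.
  move/desc_reach => r; apply: (reach_closed (D := fun x => x \in D2) r) => // a b ain bin.
  by have [] := Dcl a ain b bin.
apply: (desc_closed Dcl rD); apply: leq_trans (ltnW (size_lower_lt ht' rD)) _.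
apply: leq_trans (size_undup _) _; rewrite size_cat size_map leq_add2r.
by rewrite size_filter count_size.
Qed.

Lemma step_invariant : invariant (val (troot G)) H.
Proof.
have [rD vr _] := red_props root_in.
have [sub cl] := rw_nodes.
split; first by rewrite mem_undup; apply: desc_self.
exists val', ht', N'; split; last exact: vr.
by apply: good_sub step_good sub _ cl.
Qed.

(** The source of termination: a surviving node either is an old node other than the redex, with its
    label, or carries no defined symbol at or above [g]. *)
Lemma step_labels x : x \in tnodes H ->
  [/\ x \in tnodes G, x <> w & tlab H x = tlab G x] \/
  (forall q, tlab H x = Some (inr q) -> q < g).
Proof.
have [sub _] := rw_nodes.
case/sub/D2_cases => [[xin xw]|[z zin ->]].
  by left; split=> //; apply: lab1_old.
right=> q; rewrite [tlab H _]lab1_new // => lE.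
have [Lz zlt _] := mem_nn zin.
have [s [sE _ _ [_ _ cok]]] := env_rest Lz zlt.
move: cok; have -> : s = inr q by rewrite lE in sE; case: sE.
by case/(_ q erefl).
Qed.

Lemma step_redex : w \in tnodes G /\ tlab G w = Some (inr g).
Proof. by split; [exact: w_in | case: w_lab]. Qed.

End Step.
End Semantics.

(** * Termination and correctness *)

(** The largest index is the most significant; components below [r] may grow arbitrarily, as a step
    may create many nodes with smaller symbols. *)
Definition lexlt n (c' c : nat -> nat) : Prop :=
  exists r, [/\ r < n, c' r < c r & forall i, r < i -> i < n -> c' i <= c i].

(** Induction on the number of components, then on a bound for the top one, then on accessibility in
    the remaining components: a step either lowers the top component or decreases the rest without
    raising it. *)
Lemma lexlt_wf n c : Acc (lexlt n) c.
Proof.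
elim: n c => [|n IHn] c; first by constructor=> c' [r []].
suff H m : forall c, c n < m -> Acc (lexlt n.+1) c by apply: (H (c n).+1).
elim: m => [|m IHm] {}c; first by rewrite ltn0.
elim: (IHn c) => {}c _ IHc cm; constructor=> c' [r [rn cr ci]].
case: (ltngtP r n) => [lt|gt|E]; last 1 first.
- by apply: IHm; rewrite -E; apply: leq_trans cr _; rewrite E.
- apply: IHc; first by exists r; split=> // i ri iltn; apply: ci => //; apply: leqW.
  exact: leq_ltn_trans (ci n lt (ltnSn n)) cm.
- by lia.
Qed.

Lemma eq_map_mem (A B : eqType) (C : Type) (f : A -> C) (h : B -> C) s ts :
  map f s = map h ts -> forall x, x \in s -> exists2 t, t \in ts & f x = h t.
Proof.
elim: s ts => [|x s IH] [|t ts] //= [E /IH{}IH] y; rewrite inE => /predU1P[->|/IH[u uin ->]].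
  by exists t; rewrite ?mem_head.
by exists u; rewrite ?inE ?uin ?orbT.
Qed.

Lemma eq_map_impl (A B : eqType) (C : Type) (f f' : A -> C) (h : B -> C) s ts :
  map f s = map h ts -> (forall x t, x \in s -> t \in ts -> f x = h t -> f' x = h t) ->
  map f' s = map h ts.
Proof.
elim: s ts => [|x s IH] [|t ts] //= [E Es] H; congr cons.
  by apply: H; rewrite ?mem_head.
by apply: IH => // y u yin uin; apply: H; rewrite inE ?yin ?uin orbT.
Qed.

Section Computation.
Variables (nC : nat) (arC : 'I_nC -> nat) (c0 : 'I_nC).
Notation d0 := (CT c0 [::]).
Variables (P : seq (entry nC)) (P_gt0 : 0 < size P) (P_ok : program_ok arC c0 P).
Notation ent j := (nth (entry0 c0) P j).
Notation S := (psig arC c0 P).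
Notation R := (@prules nC arC c0 P).

Lemma step_inv t G H : invariant t G -> step R G H -> invariant t H.
Proof.
move=> [rin [val [ht [N [gd <-]]]]] [p [phi [psi [[g [rd [erd ->]]] hom fresh inj eqH]]]].
apply: invariant_eq eqH _.
exact: (step_invariant P_gt0 P_ok gd erd hom fresh inj rin).
Qed.

Definition has_rank (G : tgraph S) r x :=
  if tlab G x is Some (inr q) then (nat_of_ord q == r) else false.
Definition count_rank (G : tgraph S) r := count (has_rank G r) (undup (tnodes G)).

(** For [r >= g] the nodes of rank [r] after the step form a subset of those before it, with the
    redex left out. This compares all counts from [g] upwards, and the redex itself makes the count
    at [g] drop. *)
Lemma step_lexlt t G H : invariant t G -> step R G H ->
  lexlt (nD S) (count_rank H) (count_rank G).
Proof.
move=> [rin [val [ht [N [gd _]]]]] [p [phi [psi [[g [rd [erd ->]]] hom fresh inj [_ nE lE]]]]].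
have [win wlab] := step_redex P_gt0 P_ok erd hom.
have labs x : x \in tnodes H ->
    [/\ x \in tnodes G, x <> phi (size (pre rd)) & tlab H x = tlab G x] \/
    (forall q, tlab H x = Some (inr q) -> q < g).
  move=> xin; have [-> _] := lE x xin; rewrite nE in xin.
  have HH := step_labels P_gt0 P_ok gd erd hom fresh inj rin. exact: HH x xin.
have sub r : g <= r -> {subset [seq x <- undup (tnodes H) | has_rank H r x] <=
    [seq x <- undup (tnodes G) | has_rank G r x & x != phi (size (pre rd))]}.
  move=> gr x; rewrite !mem_filter !mem_undup => /andP[hr /labs[[xin /eqP xw E]|H1]].
    by move: hr; rewrite /has_rank E xin xw => ->.
  move: hr; rewrite /has_rank; case: (tlab H x) H1 => [[//|q]|//] /(_ q erefl) qg /eqP E.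
  by move: qg; rewrite E; lia.
have un r : uniq [seq x <- undup (tnodes H) | has_rank H r x].
  by rewrite filter_uniq ?undup_uniq.
exists g; rewrite /count_rank -!size_filter; split; first exact: ltn_ord.
  apply: leq_ltn_trans (uniq_leq_size (un _) (sub _ (leqnn _))) _.
  set w := phi _ in win wlab *; set F := filter _ _.
  have: uniq (w :: F) by rewrite /= filter_uniq ?undup_uniq // mem_filter eqxx andbF.
  move/uniq_leq_size; apply => x; rewrite inE mem_filter => /predU1P[->|/andP[/andP[hr _] xin]].
    by rewrite mem_filter mem_undup win /has_rank wlab eqxx.
  by rewrite mem_filter hr.
move=> i gi _; rewrite -!size_filter.
apply: leq_trans (uniq_leq_size (un i) (sub i (ltnW gi))) _.
by rewrite !size_filter; apply: sub_count => x /= /andP[].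
Qed.

Lemma step_terminates t G : invariant t G -> Acc (fun H G => step R G H) G.
Proof.
move: {2}(count_rank G) (erefl (count_rank G)) => c.
elim: {c}(lexlt_wf (nD S) c) G => c _ IH G Ec inv; constructor=> H st.
by apply: (IH (count_rank H)) (step_inv inv st) => //; rewrite -Ec; apply: step_lexlt inv st.
Qed.

Lemma minimal_redex (G : tgraph S) ht v : v \in tnodes G -> ~~ is_con (tlab G v) ->
  exists w, [/\ w \in tnodes G, ~~ is_con (tlab G w) &
    forall u, u \in tnodes G -> ht u < ht w -> is_con (tlab G u)].
Proof.
move: {2}(ht v).+1 (ltnSn (ht v)) => n; elim: n v => // n IH v hv vin vl.
have [/hasP[u uin /andP[ul uv]]|/hasPn H] :=
    boolP (has (fun u => ~~ is_con (tlab G u) && (ht u < ht v)) (tnodes G)).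
  by apply: (IH u) => //; apply: leq_trans uv hv.
exists v; split=> // u uin uv; have := H u uin; by rewrite uv andbT negbK.
Qed.

Lemma fresh_max (s : seq nat) u : (foldr maxn 0 s).+1 + u \notin s.
Proof.
have H x : x \in s -> x <= foldr maxn 0 s.
  by elim: s => //= y s IH; rewrite inE => /predU1P[->|/IH]; lia.
by apply/negP => /H; lia.
Qed.

Lemma progress t G v : invariant t G -> v \in tnodes G -> ~~ is_con (tlab G v) ->
  exists H, step R G H.
Proof.
move=> [rin [val [ht [N [gd _]]]]] vin vl.
have [w [win wl wmin]] := minimal_redex ht vin vl.
have [s [sE sz aD _ hlt]] := good_node gd win.
case: s sE sz => [c|g] sE sz; first by rewrite sE in wl.
have [_ mok _ _] := entry_okP P_ok (ord_ltP P_gt0 g).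
(* [D] is taken to be the nodes ranked below the minimal redex. They are all constructors, so
   [match_ok] provides a rule together with the images [fs] of its pattern nodes. *)
have [|v' u [v'in _] Nv'|u v' [uin _] [v'in _]|||u uin|rd [fs [erd fsz fsD fsE usE]]] :=
  mok (fun v => if tlab G v is Some (inl c) then Some c else None) (tatt G) val
   (fun v => v \in tnodes G /\ ht v < ht w) N (tatt G w).
- move=> u [uin uw]; have := wmin u uin uw.
  have [s [-> usz uD uval ult]] := good_node gd uin.
  case: s usz uval => // c usz uval _; exists c; split=> //; last exact: good_wf gd _ uin.
  by move=> x xin; split; [exact: uD | exact: ltn_trans (ult x xin) uw].
- by have [_] := good_N gd v'in Nv'; apply.
- exact: good_inj gd _ _ uin v'in.
- exact: sz.
- by move=> u uin; split; [exact: aD|exact: hlt].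
- exact: good_nrm gd _ _ win sE _ uin.
pose L := size (pre rd).
pose phi u := if u < L then nth 0 fs u else w.
pose psi u := (foldr maxn 0 (tnodes G)).+1 + u.
have [/(_ rd erd)[rdok _] _ _ _] := entry_okP P_ok (ord_ltP P_gt0 g).
exists (rw_result G (rule_of g rd) phi psi), (rule_of g rd), phi, psi; split.
- by exists g, rd.
- move=> u; rewrite (ksub_root P_gt0 rdok) -/L leq_eqVlt => /predU1P[->|uL].
    rewrite {1 2}/phi ltnn; split=> // f.
    rewrite [tlab _ _](glab_root g rd) [tatt (ksub _ _) _]gatt_root => -[<-]; split=> //.
    rewrite /phi ltnn usE; apply/eq_in_map => x /(args_lt rdok); by rewrite -/L => ->.
  have pu : phi u \in fs by rewrite /phi uL mem_nth ?fsz.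
  have [puG _] := fsD _ pu; split=> // f.
  rewrite /= nth_nodes_pre //; case E: (nth None (pre rd) u) => [[c a]|//] /= [<-].
  have [] := fsE u c a E; rewrite {1 2 3}/phi uL => lE aE.
  split; first by move: lE; case: (tlab G _) => [[c'|]|] //= [->].
  rewrite aE; apply/eq_in_map => x xin.
  have [/(_ _ _ _ E)[_ /allP/(_ x xin) xu] _ _ _ _] := rdok.
  by rewrite /phi (ltn_trans xu uL).
- by move=> u _; apply: fresh_max.
- by move=> x y _ _; rewrite /psi => /addnI.
- by split.
Qed.

Lemma trep_constructors t G : invariant t G -> over_C G -> trep G (troot G) = embed S t.
Proof.
move=> [rin [val [ht [N [gd <-]]]]] oC.
have lowG x : x \in tnodes G -> forall u, u \in tatt G x -> u \in tnodes G /\ ht u < ht x.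
  by move=> xin u uin; have [s [_ _ aD _ hlt]] := good_node gd xin; split; [apply: aD|apply: hlt].
have H n v : v \in tnodes G -> size (lower (tnodes G) ht v) < n ->
    trep_f (tlab G) (tatt G) n v = embed S (val v).
  elim: n v => // n IH v vin vn /=; have := oC v vin.
  have [s [-> _ aD -> _]] := good_node gd vin; case: s => // c _ /=; congr GApp.
  rewrite -map_comp; apply/eq_in_map => u uin; have [uG uv] := lowG v vin u uin.
  by apply: IH => //; apply: leq_trans (size_lower uG uv) vn.
apply: H => //; apply: leq_trans (size_lower_lt ht rin) (size_undup _).
Qed.

(** Exhausted fuel shows up as a variable. A ground constructor term is therefore complete, and more
    fuel cannot change it. *)
Lemma trep_f_mono (lab : nat -> option (sym S)) att n v t :
  trep_f lab att n v = embed S t -> forall m, n <= m -> trep_f lab att m v = embed S t.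
Proof.
elim: n v t => [|n IH] v [c ts] //= + [|m] // nm /=.
case: (lab v) => // f [-> E]; congr GApp; apply: eq_map_impl E _ => x t _ _ /IH; exact.
Qed.

(** Values are read off the term representations and ranks are term sizes; maximal sharing is
    exactly injectivity of these values. *)
Lemma initial_invariant (g : 'I_(nD S)) xs ys (G : tgraph S) :
  inputs arC (ek (ent (nat_of_ord g))) (el (ent (nat_of_ord g))) xs ys ->
  wf_tgraph G -> Defs.closed G -> max_shared G ->
  trep G (troot G) = GApp (inr g) [seq embed S t | t <- xs ++ ys] ->
  invariant (ef (ent (nat_of_ord g)) xs ys) G.
Proof.
move=> [xsz ysz wxs wys] [Gu rin Gn _ Gr] Gc Gms rE.
set t := ef _ xs ys; set root := troot G in rin rE Gr *.
have wxy : all (wf_ct arC) (xs ++ ys) by rewrite all_cat wxs.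
have [rlab ratt] : tlab G root = Some (inr g) /\
   map (trep_f (tlab G) (tatt G) (size (tnodes G)).-1) (tatt G root) = map (embed S) (xs ++ ys).
  move: rE; rewrite /trep; case: (size _) => [//|n] /=.
  by case: (tlab G root) => // f [-> ->].
have conv v : v \in tnodes G -> v <> root -> exists c ts,
    [/\ tlab G v = Some (inl c), trep G v = embed S (CT c ts),
        map (trep G) (tatt G v) = map (embed S) ts & wf_ct arC (CT c ts)].
  move=> /Gr /clos_rt_rtn1_iff r vr.
  (* Induction along a path from the root: each edge costs one unit of fuel, and a ground term at a
     node forces ground terms at its successors. *)
  have [//|[n [u [nM uE wu]]]] : v = root \/ exists n u,
     [/\ n <= size (tnodes G), trep_f (tlab G) (tatt G) n v = embed S u & wf_ct arC u].
    elim: r {vr} => [|x y xy _ IH]; [by left|right].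
    case: IH => [xr|[n [u [nM uE wu]]]].
      rewrite /succ xr in xy; have [u uin uE] := eq_map_mem ratt xy.
      exists (size (tnodes G)).-1, u; split=> //; first exact: leq_pred.
      by move/allP: wxy; apply.
    case: n u nM uE wu => [|n] [c ts] // nM /=; case: (tlab G x) => // f [_ E] /andP[_ /allP wts].
    have [u uin uE] := eq_map_mem E xy.
    by exists n, u; split=> //; [exact: ltnW | exact: wts].
  have tE := trep_f_mono uE nM.
  case: n u nM uE tE wu => [|n] [c ts] // nM uE tE wu; exists c, ts; split=> //.
    by move: uE => /=; case: (tlab G v) => // f [->].
  move: uE => /=; case: (tlab G v) => // f [_ E].
  apply: eq_map_impl E _ => x s _ _ /trep_f_mono; apply; exact: ltnW.
have ratt' : map (trep G) (tatt G root) = map (embed S) (xs ++ ys).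
  apply: eq_map_impl ratt _ => x s _ _ /trep_f_mono; apply; exact: leq_pred.
have nroot v s : trep G v = embed S s -> v <> root.
  by move=> vE E; rewrite E rE in vE; case: s vE.
pose val v := if v == root then t else unembed d0 (trep G v).
have valE v s : trep G v = embed S s -> val v = s.
  by move=> vE; rewrite /val (introF eqP (nroot _ _ vE)) vE embedK.
have valsE vs ss : map (trep G) vs = map (embed S) ss -> map val vs = ss.
  by elim: vs ss => [|v vs IH] [|s ss] //= [/valE-> /IH->].
(* The root is measured as if its arguments stood under a constructor; the head [c0] is
   arbitrary. *)
pose ht v := if v == root then csize (CT c0 (xs ++ ys)) else csize (val v).
have htE v s : trep G v = embed S s -> ht v = csize s.
  by move=> vE; rewrite /ht (introF eqP (nroot _ _ vE)) (valE _ _ vE).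
have ht_lt c vs ss v : map (trep G) vs = map (embed S) ss -> v \in vs ->
    ht v < csize (CT c ss).
  by move=> E vin; have [s sin /htE->] := eq_map_mem E vin; apply: csize_arg.
(* Every node but the root may be counted as normal, since the whole initial graph is maximally
   shared. *)
split=> //; exists val, ht, (fun v => v <> root).
split; last by rewrite /val eqxx.
have wfg : wf_ct arC t.
  have [_ _ _ wf] := entry_okP P_ok (ord_ltP P_gt0 g); exact: wf.
split.
- move=> v vin; have [/allP aD asz] := Gn v vin; case: (v =P root) => vr.
    exists (inr g); rewrite vr in asz aD *; rewrite rlab in asz *; split=> //.
      rewrite /val eqxx (valsE _ _ ratt') /appl /= take_size_cat // drop_size_cat //.
    by move=> u uin; rewrite /(ht root) eqxx; apply: ht_lt ratt' uin.
  have [c [ts [lE tE attE wts]]] := conv v vin vr.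
  exists (inl c); rewrite lE in asz *; split=> //.
    by rewrite (valE _ _ tE) (valsE _ _ attE).
  by move=> u uin; rewrite (htE _ _ tE); apply: ht_lt attE uin.
- move=> v vin; case: (v =P root) => [->|vr]; first by rewrite /val eqxx.
  by have [c [ts [_ /valE-> _ ?]]] := conv v vin vr.
- move=> v q vin vl; case: (v =P root) => [->|vr].
    move=> u uin; have [s _ /nroot] := eq_map_mem ratt' (mem_take uin); exact.
  by have [c [ts [lE]]] := conv v vin vr; rewrite lE in vl.
- move=> v vin vr; have [c [ts [-> _ attE _]]] := conv v vin vr; split=> // u uin.
  have [s _ /nroot] := eq_map_mem attE uin; exact.
- move=> u v uin vin ur vr; have [c [ts [_ uE _ _]]] := conv u uin ur.
  have [c' [ts' [_ vE _ _]]] := conv v vin vr.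
  rewrite (valE _ _ uE) (valE _ _ vE) => E; apply: NNPP => /(Gms u v uin vin); apply.
  by rewrite uE vE E.
Qed.

Lemma program_computes i : i < size P ->
  computes R (inord i : 'I_(nD S)) (ek (ent i)) (el (ent i)) (ef (ent i)).
Proof.
move=> ilt; have gE : (inord i : 'I_(nD S)) = i :> nat by rewrite inordK ?prednK.
split; [by rewrite /= gE | by move=> j _; rewrite /= gE |].
move=> xs ys inp G wfG cG msG rE.
have inv : invariant (ef (ent i) xs ys) G.
  rewrite -{1}gE; apply: initial_invariant rE => //; by rewrite gE.
split; first exact: step_terminates inv.
move=> H /clos_rt_rtn1_iff st nf.
have invH : invariant (ef (ent i) xs ys) H.
  by elim: st {nf} => // H1 H2 st12 _ IH; apply: step_inv IH st12.
have oC : over_C H.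
  by move=> v vin; apply/negP => /negP vl; apply: nf; apply: progress invH vin vl.
by split=> //; apply: trep_constructors.
Qed.
End Computation.

(** * Compiling safe recursive functions *)

Lemma mem_In (T : eqType) (x : T) s : x \in s <-> List.In x s.
Proof.
elim: s => //= y s IH; rewrite inE; split=> [/predU1P[->|/IH]|[->|/IH->]]; rewrite ?eqxx ?orbT //.
- by left.
- by right.
Qed.

Lemma seq_choice (A : Type) (x0 : A) (Q : A -> nat -> Prop) s :
  (forall x, List.In x s -> exists y, Q x y) ->
  exists ys, size ys = size s /\ forall j, j < size s -> Q (nth x0 s j) (nth 0 ys j).
Proof.
elim: s => [|x s IH] H; first by exists [::].
have [|ys [sz yQ]] := IH; first by move=> y yin; apply: H; right.
have [y xy] := H x (or_introl erefl).
by exists (y :: ys); split=> [|[|j]] /=; rewrite ?sz //; apply: yQ.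
Qed.

(** The defining equations constrain [f] on valid inputs only, so they can be chained only if
    intermediate values are valid again. *)
Lemma GSR_wf nC (arC : 'I_nC -> nat) k l f : GSR arC k l f ->
  forall xs ys, inputs arC k l xs ys -> wf_ct arC (f xs ys).
Proof.
elim=> {k l f}.
- by move=> k l j f aj fE xs ys /fE-> /=; rewrite aj.
- by move=> j f fE xs ys inp; rewrite fE //=; case: inp => _ -> _ ->; rewrite eqxx.
- move=> k l j f _ fE xs ys inp; have E := fE _ _ inp; case: inp => _ _ wx wy.
  have: all (wf_ct arC) (xs ++ ys) by rewrite all_cat wx.
  by move/allP; apply; apply/onthP; exists j.
- move=> i f _ fE xs [|t [|? ?]] inp; try by case: inp.
  by rewrite (fE _ _ t inp) //; case: inp => _ _ _ /andP[].
- move=> i j f ji fE xs [|[c ts] [|? ?]] inp; try by case: inp.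
  rewrite (fE _ _ c ts inp) //; case: inp => _ _ _ /= /andP[/andP[/eqP sz wts] _].
  case: eqP => [ci|_] /=; last by rewrite sz eqxx.
  by apply: (all_nthP _ wts); rewrite sz ci.
- move=> f fE xs [|[c ts] us] inp; first by case: inp.
  rewrite (fE _ _ c ts us inp) //; case: inp => _ /= [sz] _ /andP[_ wus].
  by apply: (all_nthP _ wus); rewrite sz.
- move=> k l m n h js gs f _ IHh jsm jsk gsn _ IHg fE xs ys inp; rewrite fE //.
  apply: IHh; have [xsz _ wx _] := inp; split.
  + rewrite /sel size_pmap -jsm; apply/eqP; rewrite -all_count.
    by apply/allP => j /(allP jsk) /=; rewrite onthTE xsz.
  + by rewrite size_map.
  + apply/allP => x; rewrite mem_pmap => /mapP[j _ E].
    by apply: (allP wx); apply/onthP; exists j.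
  + elim: gs IHg {gsn fE} => //= g gs IH IHg; rewrite IHg ?IH //=; last by left.
    by move=> g' g'in; apply: IHg; right.
move=> k l hs f _ IHh fE [|t xs] ys inp; first by case: inp.
elim/cterm_ind_in: t inp => c ts IHt [/= [xsz] ysz /andP[/andP[/eqP tsz wts] wx] wy].
rewrite fE //; last by split; rewrite ?size_cat ?tsz ?xsz ?all_cat ?wts.
apply: IHh; split; rewrite ?size_cat ?size_map ?tsz ?xsz ?ysz ?all_cat ?wts ?wy //=.
rewrite all_map; apply/allP => t tin; apply: IHt => //.
by split=> //=; rewrite ?xsz // wx (allP wts).
Qed.

Section Entries.
Variables (nC : nat) (arC : 'I_nC -> nat) (c0 : 'I_nC).
Notation d0 := (CT c0 [::]).
Notation entry := (entry nC).
Notation preach p := (clos_refl_trans nat (psucc p)).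

(** * Entries with a single rule whose arguments are all variables *)

Section VarRules.
Variables (k l : nat) (f : fn nC) (code : seq (('I_nC + nat) * seq nat)) (r : nat).

Definition var_rd := RD (nseq (k + l) None) (iota 0 (k + l)) code r.
Definition var_entry : entry := Entry k l f (fun rd => rd = var_rd).

Lemma var_entry_ok P i : nth (entry0 c0) P i = var_entry ->
  (forall xs ys, inputs arC k l xs ys -> wf_ct arC (f xs ys)) ->
  (forall j s a, onth code j = Some (s, a) ->
    [/\ size a = arR arC c0 P s, all (fun x => (x < (k + l).+1 + j) && (x != k + l)) a &
      forall q, s = inr q -> q < i /\
        all (fun x => x < k) (take (ek (nth (entry0 c0) P q)) a)]) ->
  r < (k + l).+1 + size code -> r <> k + l ->
  (forall xs ys, inputs arC k l xs ys ->
    nth d0 (run c0 P (rcons (xs ++ ys) d0) code) r = f xs ys) ->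
  entry_ok arC c0 P i.
Proof.
move=> iE fwf cok rlt rneq sem; rewrite /entry_ok iE; split.
- move=> _ ->; split.
    rewrite /rd_ok /var_rd /= size_nseq size_iota iE; split=> //.
    + by move=> j c a; rewrite nth_nseq; case: ifP.
    + by split=> //; apply/allP => x; rewrite mem_iota.
    + by move=> j jlt; exists j; [rewrite mem_iota | apply: rt_refl].
    + move=> j s a /cok[asz aok qok]; split; rewrite /= ?size_nseq //.
      move=> q /qok[qi tk]; split=> // x /(allP tk) xk; exists x; last exact: rt_refl.
      by rewrite iE /= take_iota mem_iota; lia.
  move=> vs /=; rewrite size_nseq => vsz wvs _.
  have inp : inputs arC k l (take k vs) (drop k vs).
    split; rewrite ?size_drop ?size_takel ?vsz ?leq_addr ?addKn //.
      by apply/allP => x /mem_take/(allP wvs).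
    by apply/allP => x /mem_drop/(allP wvs).
  rewrite map_nth_iota0 ?vsz // [take (k + l) vs]take_oversize ?vsz // iE /=.
  by have := sem _ _ inp; rewrite cat_take_drop.
- move=> lab att val D N us _ _ _ usz usD _; exists var_rd, us; split=> //.
  + by rewrite usz /= size_nseq.
  + by move=> j c a; rewrite /= nth_nseq; case: ifP.
  by rewrite map_nth_iota0 ?usz // take_oversize ?usz.
- by left; exists [:: var_rd] => rd ->; left.
- exact: fwf.
Qed.
End VarRules.

(** * Entries with one rule per constructor of the first safe argument *)

Section CaseRules.
Variables (l : nat) (f : fn nC) (r : 'I_nC -> nat).

(** Nodes below [arC c] are the arguments of the inspected constructor, node [arC c] is that
    constructor, and [l] variables follow. Nothing is created: the result [r c] is a node of the
    pattern. *)
Definition case_rd c := RD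
  (nseq (arC c) None ++ Some (c, iota 0 (arC c)) :: nseq l None)
  (iota (arC c) l.+1) [::] (r c).
Definition case_entry : entry := Entry 0 l.+1 f (fun rd => exists c, rd = case_rd c).

Lemma size_case_rd c : size (pre (case_rd c)) = arC c + l.+1.
Proof. by rewrite size_cat /= !size_nseq. Qed.

Lemma case_rd_pre c j c' a : nth None (pre (case_rd c)) j = Some (c', a) ->
  [/\ j = arC c, c' = c & a = iota 0 (arC c)].
Proof.
rewrite nth_cat size_nseq nth_nseq; case: ltnP => [jlt|jge] //.
case E: (j - arC c) => [|n] /=; first by case=> <- <-; split=> //; lia.
by rewrite nth_nseq if_same.
Qed.

Lemma case_entry_ok P i : nth (entry0 c0) P i = case_entry ->
  (forall xs ys, inputs arC 0 l.+1 xs ys -> wf_ct arC (f xs ys)) ->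
  (forall c, r c < arC c + l.+1) ->
  (forall c ts us, inputs arC 0 l.+1 [::] (CT c ts :: us) ->
    nth d0 (ts ++ CT c ts :: us) (r c) = f [::] (CT c ts :: us)) ->
  entry_ok arC c0 P i.
Proof.
move=> iE fwf rlt sem; rewrite /entry_ok iE; split.
- move=> _ [c ->]; split.
    rewrite /rd_ok size_case_rd; split.
    + move=> j c' a /case_rd_pre[-> -> ->]; rewrite size_iota; split=> //.
      by apply/allP => x; rewrite mem_iota.
    + by split; [rewrite /= iE size_iota | apply/allP => x; rewrite mem_iota => /andP[]].
    + move=> j jlt; case: (ltnP j (arC c)) => ja.
        exists (arC c); first exact: mem_head.
        apply: rt_step; exists c, (iota 0 (arC c)); rewrite mem_iota; split=> //.
        by rewrite /= nth_cat size_nseq ltnn subnn.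
      by exists j; [rewrite mem_iota ja | apply: rt_refl].
    + by move=> j s a; rewrite /= onth0n.
    + by rewrite /= addn0; have := rlt c; split; lia.
  move=> vs; rewrite size_case_rd => vsz wvs cons /=.
  have aE : nth d0 vs (arC c) = CT c (take (arC c) vs).
    rewrite (cons _ c (iota 0 (arC c))); last by rewrite /= nth_cat size_nseq ltnn subnn.
    by rewrite map_nth_iota0 // vsz leq_addr.
  have dE : drop (arC c) vs = CT c (take (arC c) vs) :: drop (arC c).+1 vs.
    by rewrite -aE; apply: drop_nth; rewrite vsz; lia.
  rewrite nth_rcons vsz rlt -[LHS](congr1 (fun s => nth d0 s (r c)) (cat_take_drop (arC c) vs)).
  rewrite -[_ :: [seq _ | _ <- _]]/([seq nth d0 vs x | x <- iota (arC c) l.+1]) map_nth_iota ?vsz ?addKn //.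
  rewrite (take_oversize (n := l.+1)) ?size_drop ?vsz ?addKn // iE /= take0 drop0 dE sem //.
  rewrite -dE; split; rewrite ?size_drop ?vsz ?addKn //.
  by apply/allP => x /mem_drop/(allP wvs).
- move=> lab att val D N [|u us] // Dok _ _ [usz] usD _.
  have [c [labu attu attD valu _]] := Dok u (usD u (mem_head _ _)).
  exists (case_rd c), (att u ++ u :: us); split.
  + by exists c.
  + by rewrite size_case_rd size_cat attu /= usz.
  + move=> x; rewrite mem_cat => /orP[/attD//|]; exact: usD.
  + move=> j c' a /case_rd_pre[-> -> ->]; rewrite nth_cat attu ltnn subnn /= -{1}attu.
    by rewrite map_nth_iota0 ?size_cat ?leq_addr // take_size_cat.
  rewrite -[args _]/(iota (arC c) l.+1) map_nth_iota; last by rewrite size_cat attu /= usz addKn.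
  by rewrite -attu drop_size_cat // take_oversize //= usz.
- left; exists [seq case_rd c | c <- enum 'I_nC] => _ [c ->].
  by apply/List.in_map/mem_In; rewrite mem_enum.
- exact: fwf.
Qed.
End CaseRules.

Lemma code_bound_index a b c j : a < b -> (a < (b + c).+1 + j) && (a != b + c).
Proof. lia. Qed.

Lemma code_bound_rec a b j : a < j -> (b.+1 + a < b.+1 + j) && (b.+1 + a != b).
Proof. lia. Qed.

(** * Recursion entries: one rule per ground term *)

Section RecRules.
Variables (k l : nat) (f : fn nC) (hs : 'I_nC -> nat).

Definition rec_entry : entry :=
  Entry k.+1 l f (fun rd => exists2 t, wf_ct arC t & rd = rec_rd k l hs t).

Lemma size_rec_rd t : size (pre (rec_rd k l hs t)) = size (subs t) + (k + l).
Proof. by rewrite size_cat size_map size_nseq. Qed.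

Lemma rec_rd_pre t j c a : nth None (pre (rec_rd k l hs t)) j = Some (c, a) ->
  exists s, [/\ j < size (subs t), s = nth d0 (subs t) j, s \in subs t, c = chd s &
                a = [seq index u (subs t) | u <- cargs s]].
Proof.
rewrite nth_cat size_map; case: ltnP => jlt; last by rewrite nth_nseq if_same.
by rewrite (nth_map d0) // => -[<- <-]; exists (nth d0 (subs t) j); rewrite mem_nth.
Qed.

Lemma rec_rd_pre_nth t s : s \in subs t ->
  nth None (pre (rec_rd k l hs t)) (index s (subs t)) =
  Some (chd s, [seq index u (subs t) | u <- cargs s]).
Proof. by move=> sin; rewrite nth_cat size_map index_mem sin (nth_map d0) ?index_mem // nth_index. Qed.

Lemma rec_rd_reach t u s : u \in subterms t -> s \in subterms u ->
  preach (pre (rec_rd k l hs t)) (index u (subs t)) (index s (subs t)).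
Proof.
elim/cterm_ind_in: u s => c ts IH s uin /subtermsP[->|[v vin sv]]; first exact: rt_refl.
apply: rt_trans (IH v vin s (subterms_arg uin vin) sv).
apply: rt_step; exists c, [seq index u (subs t) | u <- ts].
by split; [rewrite rec_rd_pre_nth ?mem_subs | apply: (map_f (index^~ (subs t)))].
Qed.

Lemma rec_entry_ok P i : nth (entry0 c0) P i = rec_entry ->
  (forall xs ys, inputs arC k.+1 l xs ys -> wf_ct arC (f xs ys)) ->
  (forall c, hs c < i /\ ek (nth (entry0 c0) P (hs c)) = arC c + k /\
                         el (nth (entry0 c0) P (hs c)) = l + arC c) ->
  (forall c ts xs ys, inputs arC (arC c + k) l (ts ++ xs) ys -> size ts = arC c ->
     f (CT c ts :: xs) ys = ef (nth (entry0 c0) P (hs c))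
       (ts ++ xs) (ys ++ [seq f (t :: xs) ys | t <- ts])) ->
  entry_ok arC c0 P i.
Proof.
move=> iE fwf hok sem; rewrite /entry_ok iE; split.
- move=> _ [t wt ->].
  have tin : t \in subs t by rewrite mem_subs subterms_refl.
  have sargs s : s \in subs t -> size (cargs s) = arC (chd s).
    by case: s => c ts; rewrite mem_subs => /(subterms_wf wt) /= /andP[/eqP].
  have idx_in s u : s \in subs t -> u \in cargs s -> u \in subs t.
    by case: s => c ts; rewrite !mem_subs => /subterms_arg; apply.
  have onthc j s a : onth (rest (rec_rd k l hs t)) j = Some (s, a) ->
      exists u, [/\ u \in subs t, j = index u (subs t), s = inr (hs (chd u)) &
        a = [seq index v (subs t) | v <- cargs u] ++ iota (size (subs t)) (k + l) ++
            [seq (size (subs t) + (k + l)).+1 + index v (subs t) | v <- cargs u]].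
    rewrite onth_map; case E: (onth (subs t) j) => [u|] //= [<- <-].
    have jlt : j < size (subs t) by rewrite -onthTE E.
    have uE : nth d0 (subs t) j = u by apply: onth_nth.
    by exists u; split=> //; rewrite -uE ?mem_nth // index_uniq ?subs_uniq.
  split.
    rewrite /rd_ok size_rec_rd; split.
    + move=> j c a /rec_rd_pre[s [jlt sE sin -> ->]]; rewrite size_map sargs //.
      split=> //; apply/allP => _ /mapP[u uin ->].
      by rewrite sE in uin; have [] := nth_subs_arg jlt uin.
    + rewrite /= iE size_iota; split; first by rewrite addSn.
      have := tin; rewrite -index_mem => tlt; apply/andP; split; first exact: leq_trans tlt (leq_addr _ _).
      by apply/allP => x; rewrite mem_iota => /andP[].
    + move=> j jlt; case: (ltnP j (size (subs t))) => jm.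
        exists (index t (subs t)); first exact: mem_head.
        have := rec_rd_reach (s := nth d0 (subs t) j) (subterms_refl t).
        rewrite -mem_subs mem_nth // index_uniq ?subs_uniq //; exact.
      by exists j; [rewrite inE mem_iota jm jlt orbT | apply: rt_refl].
    + move=> j _ _ /onthc[s [sin -> -> ->]].
      have [hlt [hk hl]] := hok (chd s).
      split.
      * by rewrite /= !size_cat !size_map size_iota hk hl sargs //; lia.
      * rewrite size_rec_rd !all_cat; apply/and3P; split; apply/allP => x.
        -- by move=> /mapP[u uin ->]; apply: code_bound_index; rewrite index_mem (idx_in s).
        -- by rewrite mem_iota; lia.
        -- move=> /mapP[u uin ->].
           have := subs_index_arg (t := t) (c := chd s) (ts := cargs s) (u := u).
           by rewrite -ctE => /(_ sin uin) /code_bound_rec; apply.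
      (* The normal arguments of a created node are subterms of [t], all below the node of [t], and
         the first [k] variables; both lie below normal arguments of the left root. *)
      * move=> q [<-]; split=> // x; rewrite hk iE /=.
        rewrite take_cat size_map sargs // ltnNge leq_addr /= addKn mem_cat.
        rewrite takel_cat ?size_iota ?leq_addr // take_iota => /orP[/mapP[u uin ->]|xin].
          exists (index t (subs t)); first exact: mem_head.
          by apply: rec_rd_reach; rewrite ?subterms_refl // -mem_subs (idx_in s).
        exists x; last exact: rt_refl.
        by rewrite inE xin orbT.
    + rewrite /= size_map; move: tin; rewrite -index_mem => /code_bound_rec H.
      by have /andP[? /eqP] := H (size (subs t) + (k + l)).
  set m := size (subs t); set L := m + (k + l).
  move=> vs; rewrite size_rec_rd -/m -/L => vsz wvs cons.
  set env := run _ _ _ _.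
  have vsE s : s \in subs t -> nth d0 vs (index s (subs t)) = s.
    elim/cterm_ind_in: s => c ts IH sin.
    rewrite (cons _ _ _ (rec_rd_pre_nth sin)) /= -map_comp; congr CT.
    rewrite -[RHS]map_id; apply/eq_in_map => u uin /=; apply: IH => //.
    exact: idx_in sin uin.
  have envE x : x < L -> nth d0 env x = nth d0 vs x.
    by move=> xL; rewrite nth_run_lt ?size_rcons ?vsz ?nth_rcons ?vsz ?xL //; lia.
  set xs := take k (drop m vs); set ys := drop k (drop m vs).
  have xyE : xs ++ ys = drop m vs by apply: cat_take_drop.
  have dsz : size (drop m vs) = k + l by rewrite size_drop vsz /L addKn.
  have xsz : size xs = k by rewrite size_takel ?dsz ?leq_addr.
  have ysz : size ys = l by rewrite size_drop dsz addKn.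
  have wxy : all (wf_ct arC) (xs ++ ys) by rewrite xyE; apply/allP => x /mem_drop/(allP wvs).
  have [wx wy] : all (wf_ct arC) xs /\ all (wf_ct arC) ys by apply/andP; rewrite -all_cat.
  (* Soundness of the unfolded recursion: by induction on the subterm, the created node for [s]
     evaluates to the recursive value at [s]. *)
  have recE s : s \in subs t -> nth d0 env (L.+1 + index s (subs t)) = f (s :: xs) ys.
    elim/cterm_ind_in: s => c ts IH sin.
    have := @nth_run _ c0 P (rcons vs d0) (rest (rec_rd k l hs t)) (index (CT c ts) (subs t))
      (inr (hs c)) ([seq index v (subs t) | v <- ts] ++ iota m (k + l) ++
            [seq L.+1 + index v (subs t) | v <- ts]).
    rewrite size_rcons vsz => ->.
    - have wct := sargs _ sin; rewrite /= in wct.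
      have tsin u : u \in ts -> u \in subs t by apply: idx_in sin.
      have wts : all (wf_ct arC) ts.
        by apply/allP => u /tsin; rewrite mem_subs; apply: subterms_wf.
      have [_ [hk _]] := hok c.
      rewrite /appl hk sem //; last by split; rewrite ?size_cat ?wct ?xsz ?ysz ?all_cat ?wts ?wx ?wy.
      rewrite !map_cat -!map_comp -/env.
      have -> : [seq (nth d0 env \o index^~ (subs t)) v | v <- ts] = ts.
        rewrite -[RHS]map_id; apply/eq_in_map => u uin /=.
        have ui := tsin u uin; rewrite envE ?vsE //.
        by apply: leq_trans (leq_addr _ _); rewrite index_mem.
      have -> : [seq nth d0 env x | x <- iota m (k + l)] = xs ++ ys.
        rewrite xyE -[RHS](take_oversize (n := k + l)) ?dsz // -(map_nth_iota d0) -?size_drop ?dsz //.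
        by apply/eq_in_map => x; rewrite mem_iota => /andP[_ xin]; apply: envE.
      have -> : [seq (nth d0 env \o (fun v => L.+1 + index v (subs t))) v | v <- ts] =
                [seq f (u :: xs) ys | u <- ts].
        by apply/eq_in_map => u uin /=; apply: IH => //; apply: tsin.
      rewrite -catA catA take_cat drop_cat size_cat wct xsz ltnn subnn take0 drop0 cats0 //.
    - rewrite onth_map; have -> : onth (subs t) (index (CT c ts) (subs t)) = Some (CT c ts).
        by rewrite onthE (nth_map d0) ?index_mem // nth_index.
      by [].
    - rewrite !all_cat; apply/and3P; split; apply/allP => x.
      + move=> /mapP[u uin ->]; have ui : index u (subs t) < m by rewrite index_mem (idx_in _ _ sin).
        by case/andP: (code_bound_index (k + l) (index (CT c ts) (subs t)) ui).
      + by rewrite mem_iota => /andP[_ /leq_trans]; apply; rewrite ltnW // ltnS leq_addr.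
      + by move=> /mapP[u uin ->]; case/andP: (code_bound_rec L (subs_index_arg sin uin)).
  rewrite /= recE // iE /= vsE // map_nth_iota -?size_drop ?dsz //.
  by rewrite (take_oversize (n := k + l)) ?dsz.
- move=> lab att val D N [|u us] // Dok Ncl Ninj [usz] usD usN.
  have Du : D u by apply: usD; apply: mem_head.
  have Nu : N u by apply: usN; rewrite /= mem_head.
  have sub_node x s : D x -> N x -> s \in subterms (val x) -> exists y, [/\ D y, N y & val y = s].
    move E: (val x) => v; elim/cterm_ind_in: v x s E => c ts IH x s xE Dx Nx /subtermsP[->|[v vin sv]].
      by exists x.
    have [c' [_ _ attD vE _]] := Dok x Dx; rewrite vE in xE; case: xE => _ tsE.
    have [y yin yE] : exists2 y, y \in att x & v = val y by apply/mapP; rewrite tsE.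
    apply: (IH v vin y s (esym yE) _ _ sv); first exact: attD.
    exact: Ncl _ _ Dx Nx yin.
  set t := val u; set m := size (subs t).
  have [|fs0 [fsz fsQ]] := @seq_choice _ d0 (fun s y => [/\ D y, N y & val y = s]) (subs t).
    by move=> s /mem_In; rewrite mem_subs; apply: sub_node.
  have wt : wf_ct arC t by have [c []] := Dok u Du.
  have tin : t \in subs t by rewrite mem_subs subterms_refl.
  (* The nodes in [fs0] were chosen by value alone. Injectivity of [val] on [N] forces them to be
     the actual successors in the graph, so the closed pattern matches. *)
  have fsE x : D x -> N x -> val x \in subs t -> nth 0 (fs0 ++ us) (index (val x) (subs t)) = x.
    move=> Dx Nx xin; have lt : index (val x) (subs t) < size (subs t) by rewrite index_mem.
    rewrite nth_cat fsz lt; have [Dy Ny vE] := fsQ _ lt.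
    by apply: Ninj => //; rewrite vE nth_index.
  exists (rec_rd k l hs t), (fs0 ++ us); split.
  + by exists t.
  + by rewrite size_rec_rd size_cat fsz usz.
  + move=> x; rewrite mem_cat => /orP[/(nthP 0)[j jlt <-]|xin].
      by rewrite fsz in jlt; have [] := fsQ j jlt.
    by apply: usD; rewrite inE xin orbT.
  + move=> j c a /rec_rd_pre[s [jlt sE sin -> ->]]; rewrite nth_cat fsz jlt.
    have [] := fsQ j jlt; rewrite -sE; set x := nth 0 fs0 j => Dx Nx vx.
    have [c' [-> _ attD vE _]] := Dok x Dx.
    rewrite -vx vE /=; split=> //; rewrite -map_comp -map_comp -[LHS]map_id.
    apply/eq_in_map => y yin /=; rewrite fsE //; [exact: attD | exact: Ncl _ _ Dx Nx yin |].
    move: sin; rewrite !mem_subs -vx vE => /subterms_arg; apply; exact: map_f.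
  rewrite /= fsE //; congr cons; rewrite -/m map_nth_iota; last first.
    by rewrite size_cat fsz -/m addKn usz.
  by rewrite /m -fsz drop_size_cat // take_oversize // usz.
- by right; exists hs, k, l; split=> // c; have [_ []] := hok c.
- exact: fwf.
Qed.
End RecRules.
End Entries.

(** * Translation of safe recursive functions into programs *)

Section Compile.
Variables (nC : nat) (arC : 'I_nC -> nat) (c0 : 'I_nC).
Notation d0 := (CT c0 [::]).
Notation program_ok := (program_ok arC c0).
Implicit Types (P Q : seq (entry nC)).

Definition impl P j k l f :=
  [/\ j < size P, ek (nth (entry0 c0) P j) = k, el (nth (entry0 c0) P j) = l &
      ef (nth (entry0 c0) P j) = f].

(** Starting from an arbitrary correct program lets the ingredients of a composition or recursion be
    compiled one after another into a common program. *)
Definition compilable k l f := forall P, program_ok P ->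
  exists Q j, program_ok (P ++ Q) /\ impl (P ++ Q) j k l f.

Lemma impl_agree P P' j k l f : (forall i, i < size P -> nth (entry0 c0) P' i = nth (entry0 c0) P i) ->
  impl P j k l f -> [/\ j < size P, ek (nth (entry0 c0) P' j) = k,
    el (nth (entry0 c0) P' j) = l & ef (nth (entry0 c0) P' j) = f].
Proof. by move=> E [jlt]; rewrite E. Qed.

Lemma impl_cat P Q j k l f : impl P j k l f -> impl (P ++ Q) j k l f.
Proof.
move=> /(@impl_agree P (P ++ Q))[i ilt|]; first by rewrite nth_cat ilt.
by split=> //; rewrite size_cat ltn_addr.
Qed.

Lemma program_rcons P e : program_ok P ->
  (forall P', (forall i, i < size P -> nth (entry0 c0) P' i = nth (entry0 c0) P i) ->
     nth (entry0 c0) P' (size P) = e -> entry_ok arC c0 P' (size P)) ->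
  program_ok (P ++ [:: e]) /\ impl (P ++ [:: e]) (size P) (ek e) (el e) (ef e).
Proof.
move=> Pok eok; split; last first.
  by rewrite /impl size_cat addn1 nth_cat ltnn subnn.
move=> i; rewrite size_cat addn1 ltnS leq_eqVlt => /predU1P[->|ilt] Q; last first.
  by rewrite takel_cat //; apply: Pok.
rewrite take_oversize ?size_cat ?addn1 //; apply: eok => [i' lt|].
  by rewrite -catA nth_cat lt.
by rewrite -catA nth_cat ltnn subnn.
Qed.

(** The index type [X] is left open because composition uses a list of functions and recursion uses
    the constructors, with arities depending on the index. *)
Lemma compile_all (X : Type) (x0 : X) (K L : X -> nat) (F : X -> fn nC) xs :
  (forall x, List.In x xs -> compilable (K x) (L x) (F x)) ->
  forall P, program_ok P -> exists Q js, [/\ program_ok (P ++ Q), size js = size xs &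
    forall i, i < size xs -> impl (P ++ Q) (nth 0 js i)
      (K (nth x0 xs i)) (L (nth x0 xs i)) (F (nth x0 xs i))].
Proof.
elim: xs => [|x xs IH] H P Pok; first by exists [::], [::]; rewrite cats0.
have [Q [j [Qok jimp]]] := H x (or_introl erefl) P Pok.
have [|Q' [js [Q'ok jsz jsimp]]] := IH _ (P ++ Q) Qok.
  by move=> y yin; apply: H; right.
exists (Q ++ Q'), (j :: js); rewrite catA; split=> //=; first by rewrite jsz.
by case=> [_|i] /=; [apply: impl_cat | apply: jsimp].
Qed.

Lemma onth1 (T : Type) (x y : T) j : onth [:: x] j = Some y -> j = 0 /\ x = y.
Proof. by case: j => [|j] //=; [case | rewrite onth0n]. Qed.

Lemma compile_var k l f code r : GSR arC k l f ->
  (forall i s a, onth code i = Some (s, a) -> exists c,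
     [/\ s = inl c, size a = arC c & all (fun x => x < k + l) a]) ->
  r < (k + l).+1 + size code -> r <> k + l ->
  (forall P xs ys, inputs arC k l xs ys ->
    nth d0 (run c0 P (rcons (xs ++ ys) d0) code) r = f xs ys) -> compilable k l f.
Proof.
move=> fG cok rlt rneq sem P Pok.
have [|ok imp] := @program_rcons P (var_entry k l f code r) Pok; last first.
  by exists [:: var_entry k l f code r], (size P).
move=> P' _ iE; apply: var_entry_ok iE _ _ rlt rneq _; last exact: sem.
  exact: GSR_wf fG.
move=> j s a /cok[c [-> asz /allP aok]]; split=> //.
by apply/allP => x /aok xlt; apply/andP; split; lia.
Qed.

Lemma nth_run1 P env s a : all (fun x => x < size env) a ->
  nth d0 (run c0 P (rcons env d0) [:: (s, a)]) (size env).+1 =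
  appl c0 P s [seq nth d0 env x | x <- a].
Proof.
move=> /allP aok; have sz : size (rcons env d0) = (size env).+1 by rewrite size_rcons.
have := @nth_run _ c0 P (rcons env d0) [:: (s, a)] 0 s a erefl.
rewrite addn0 sz => ->; last by apply/allP => x /aok; lia.
congr appl; apply/eq_in_map => x /aok xlt.
by rewrite nth_run_lt ?sz ?nth_rcons ?xlt //; lia.
Qed.

Lemma sel_nth (xs : seq (cterm nC)) js :
  all (fun j => j < size xs) js -> sel xs js = [seq nth d0 xs j | j <- js].
Proof.
by elim: js => //= j js IH /andP[jlt /IH{}IH]; rewrite /sel /= onthE (nth_map d0) //= -IH.
Qed.

Lemma compile_comp k l m n (h : fn nC) js gs f : GSR arC k l f ->
  compilable m n h -> size js = m -> all (fun j => j < k) js -> size gs = n ->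
  (forall g, List.In g gs -> compilable k l g) ->
  (forall xs ys, inputs arC k l xs ys -> f xs ys = h (sel xs js) [seq g xs ys | g <- gs]) ->
  compilable k l f.
Proof.
move=> fG hC jsm jsk gsn gC fE P Pok.
have [Q [hj [Qok himp]]] := hC P Pok.
pose f0 : fn nC := fun _ _ => d0.
have [Q' [gj [Q'ok gsz gimp]]] :=
  compile_all f0 (K := fun=> k) (L := fun=> l) (F := id) gC Qok.
rewrite gsn in gsz gimp.
(* The values of the inner functions sit at [(k + l).+1 + i] for [i < n], just after the left root,
   and the call of [h] comes last at [(k + l).+1 + n]. Only variables, through [js], enter its
   normal positions. *)
pose code : seq (('I_nC + nat) * seq nat) := [seq (inr g, iota 0 (k + l)) | g <- gj] ++
  [:: (inr hj, js ++ iota (k + l).+1 n)].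
pose e := var_entry k l f code ((k + l).+1 + n).
have [|ok imp] := @program_rcons ((P ++ Q) ++ Q') e Q'ok; last first.
  by exists (Q ++ Q' ++ [:: e]), (size ((P ++ Q) ++ Q')); rewrite !catA.
move=> P' agr iE.
have gI i := fun lt => impl_agree agr (gimp i lt).
have [hlt hk hl hE] := impl_agree agr (impl_cat Q' himp).
have codeP j s a : onth code j = Some (s, a) ->
    (exists2 i, i < n & [/\ j = i, s = inr (nth 0 gj i) & a = iota 0 (k + l)]) \/
    [/\ j = n, s = inr hj & a = js ++ iota (k + l).+1 n].
  rewrite onth_cat size_map gsz; case: ltnP => jn.
    rewrite onth_map; case E: (onth gj j) => [q|] //= [<- <-]; left; exists j => //.
    by have -> : nth 0 gj j = q by apply: onth_nth.
  by move=> H; have [jE [<- <-]] := onth1 H; right; split=> //; lia.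
apply: var_entry_ok iE _ _ _ _ _.
- exact: GSR_wf fG.
- move=> j s a /codeP[[i ilt [-> -> ->]]|[-> -> ->]].
    have [ilt' ik il iF] := gI i ilt.
    split; first by rewrite size_iota /= ik il.
      by apply/allP => x; rewrite mem_iota => /andP[_ xlt]; apply/andP; split; lia.
    move=> q [<-]; split=> //; rewrite ik take_iota; apply/allP => x; rewrite mem_iota; lia.
  split; first by rewrite size_cat size_iota /= hk hl jsm.
    rewrite all_cat; apply/andP; split; apply/allP => x; last by rewrite mem_iota; lia.
    by move/(allP jsk) => xk; apply/andP; split; lia.
  by move=> q [<-]; rewrite hk take_size_cat.
- by rewrite size_cat size_map gsz addn1 ltn_add2l.
- by lia.
move=> xs ys inp; have [xsz ysz _ _] := inp; rewrite fE //.
set env := run _ _ _ _.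
have sz : size (rcons (xs ++ ys) d0) = (k + l).+1 by rewrite size_rcons size_cat xsz ysz.
have envlt x : x < k + l -> nth d0 env x = nth d0 (xs ++ ys) x.
  by move=> xlt; rewrite nth_run_lt ?sz ?nth_rcons ?size_cat ?xsz ?ysz ?xlt //; lia.
have genv i : i < n -> nth d0 env ((k + l).+1 + i) = nth f0 gs i xs ys.
  move=> ilt; have [ilt' ik il iF] := gI i ilt.
  have := @nth_run _ c0 P' (rcons (xs ++ ys) d0) code i (inr (nth 0 gj i)) (iota 0 (k + l)).
  rewrite sz => ->.
  - have -> : [seq nth d0 env x | x <- iota 0 (k + l)] = xs ++ ys.
      transitivity [seq nth d0 (xs ++ ys) x | x <- iota 0 (k + l)].
        by apply/eq_in_map => x; rewrite mem_iota => /envlt.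
      by rewrite map_nth_iota0 ?take_oversize ?size_cat ?xsz ?ysz.
    by rewrite /= ik iF take_size_cat // drop_size_cat.
  - rewrite onth_cat size_map gsz ilt onth_map onthE (nth_map 0) ?gsz //.
  - by apply/allP => x; rewrite mem_iota; lia.
have := @nth_run _ c0 P' (rcons (xs ++ ys) d0) code n (inr hj) (js ++ iota (k + l).+1 n).
rewrite sz => ->.
- rewrite /= hk hE -/env map_cat take_size_cat ?size_map // drop_size_cat ?size_map //.
  congr (h _ _).
    rewrite sel_nth ?xsz //; apply/eq_in_map => j /(allP jsk) jk.
    by rewrite envlt ?(ltn_addr _ jk) // nth_cat xsz jk.
  apply: (@eq_from_nth _ d0) => [|i]; rewrite ?size_map size_iota ?gsn // => ilt.
  by rewrite (nth_map 0) ?size_iota // nth_iota // genv // (nth_map f0) ?gsn.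
- by rewrite onth_cat size_map gsz ltnn subnn.
- rewrite all_cat; apply/andP; split; apply/allP => x; last by rewrite mem_iota; lia.
  by move/(allP jsk); lia.
Qed.

Lemma compile_rec k l (hs : 'I_nC -> fn nC) f : GSR arC k.+1 l f ->
  (forall c, compilable (arC c + k) (l + arC c) (hs c)) ->
  (forall c ts xs ys, inputs arC (arC c + k) l (ts ++ xs) ys -> size ts = arC c ->
    f (CT c ts :: xs) ys = hs c (ts ++ xs) (ys ++ [seq f (t :: xs) ys | t <- ts])) ->
  compilable k.+1 l f.
Proof.
move=> fG hC fE P Pok.
have [|Q [js [Qok jsz jimp]]] := @compile_all _ c0 (fun c => arC c + k) (fun c => l + arC c) hs
  (enum 'I_nC) _ P Pok; first by move=> c _; apply: hC.
rewrite size_enum_ord in jsz jimp.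
pose e := rec_entry arC k l f (fun c => nth 0 js c).
have [|ok imp] := @program_rcons (P ++ Q) e Qok; last first.
  by exists (Q ++ [:: e]), (size (P ++ Q)); rewrite catA.
move=> P' agr iE.
have jI (c : 'I_nC) : [/\ nth 0 js c < size (P ++ Q),
    ek (nth (entry0 c0) P' (nth 0 js c)) = arC c + k,
    el (nth (entry0 c0) P' (nth 0 js c)) = l + arC c &
    ef (nth (entry0 c0) P' (nth 0 js c)) = hs c].
  by have := impl_agree agr (jimp c (ltn_ord c)); rewrite nth_ord_enum.
apply: rec_entry_ok iE _ _ _.
- exact: GSR_wf fG.
- by move=> c; have [? ? ? _] := jI c.
move=> c ts xs ys inp tsz; rewrite fE //.
by have [_ _ _ ->] := jI c.
Qed.

Lemma compile_case l f (r : 'I_nC -> nat) : GSR arC 0 l.+1 f ->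
  (forall c, r c < arC c + l.+1) ->
  (forall c ts us, inputs arC 0 l.+1 [::] (CT c ts :: us) ->
    nth d0 (ts ++ CT c ts :: us) (r c) = f [::] (CT c ts :: us)) ->
  compilable 0 l.+1 f.
Proof.
move=> fG rlt sem P Pok.
have [|ok imp] := @program_rcons P (case_entry arC l f r) Pok; last first.
  by exists [:: case_entry arC l f r], (size P).
by move=> P' _ iE; apply: case_entry_ok iE (GSR_wf fG) rlt sem.
Qed.

Lemma inputs_args c ts us l : inputs arC 0 l [::] (CT c ts :: us) -> size ts = arC c.
Proof. by case=> _ _ _ /= /andP[/andP[/eqP]]. Qed.

Lemma GSR_compilable k l f : GSR arC k l f -> compilable k l f.
Proof.
move=> fG; elim: fG (fG) => {k l f}.
- move=> k l j f aj fE fG; apply: (@compile_var k l f [:: (inl j, [::])] (k + l).+1) => //.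
  + by move=> i s a H; have [_ [<- <-]] := onth1 H; exists j.
  + by rewrite addn1.
  + lia.
  move=> P xs ys inp; rewrite fE //; have [xsz ysz _ _] := inp.
  by rewrite -xsz -ysz -size_cat nth_run1.
- move=> j f fE fG; apply: (@compile_var _ _ f [:: (inl j, iota 0 (arC j))] (arC j).+1) => //.
  + move=> i s a H; have [_ [<- <-]] := onth1 H; exists j; rewrite size_iota; split=> //.
    by apply/allP => x; rewrite mem_iota.
  + by rewrite addn1.
  + lia.
  move=> P xs ys inp; rewrite fE //; have [/size0nil-> ysz _ _] := inp.
  rewrite -{2}ysz nth_run1 ?ysz; last by apply/allP => x; rewrite mem_iota.
  by rewrite /= map_nth_iota0 ?take_oversize ?ysz.
- move=> k l j f jlt fE fG; apply: (@compile_var k l f [::] j) => //=; try lia.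
  + by move=> i s a; rewrite onth0n.
  move=> P xs ys inp; have := fE _ _ inp; have [xsz ysz _ _] := inp.
  by rewrite nth_rcons size_cat xsz ysz jlt => /(onth_nth d0).
(* A constant predecessor returns its argument on every input, so it is compiled as a projection. *)
- move=> i f _ fE fG; apply: (@compile_var 0 1 f [::] 0) => //=.
  + by move=> ? s a; rewrite onth0n.
  move=> P xs [|t [|? ?]] inp; try by case: inp.
  by rewrite (fE _ _ t inp) //; case: inp => /size0nil->.
(* On a constructor other than [i] the argument is returned unchanged, which is the pattern node
   [arC c]. *)
- move=> i j f ji fE fG; apply: (@compile_case 0 f (fun c => if c == i then j else arC c)) => //.
    by move=> c; case: eqP => [->|_]; lia.
  move=> c ts us inp; have tsz := inputs_args inp; case: us inp => [|? ?] inp; last by case: inp.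
  rewrite (fE _ _ c ts inp) //; case: eqP => ci.
    by rewrite nth_cat tsz ci ji; apply: set_nth_default; rewrite tsz ci.
  by rewrite nth_cat tsz ltnn subnn.
(* The offset skips the [arC c] arguments and the inspected constructor itself before selecting the
   branch numbered [c]. *)
- move=> f fE fG; apply: (@compile_case nC f (fun c => arC c + c.+1)) => //.
    by move=> c; have := ltn_ord c; lia.
  move=> c ts us inp; have tsz := inputs_args inp.
  rewrite (fE _ _ c ts us inp) // nth_cat tsz ltnNge leq_addr addKn /=.
  by apply: set_nth_default; case: inp => _ [->].
- move=> k l m n h js gs f hG IHh jsm jsk gsn gG IHg fE fG.
  apply: (compile_comp fG (IHh hG) jsm jsk gsn _ fE) => g gin.
  exact: IHg gin (gG g gin).
move=> k l hs f hG IHh fE fG; apply: (compile_rec fG _ fE) => c.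
exact: IHh c (hG c).
Qed.
End Compile.

(** * Size conditions on the recursion rules *)

Section RecursionRule.
Variables (nC : nat) (arC : 'I_nC -> nat) (c0 : 'I_nC).
Notation d0 := (CT c0 [::]).
Variables (P : seq (entry nC)) (P_gt0 : 0 < size P).
Notation ent j := (nth (entry0 c0) P j).
Notation S := (psig arC c0 P).

Lemma safe_ofE (lab : nat -> option (sym S)) att x q : lab x = Some (inr q) ->
  safe_of lab att x = drop (ek (ent (nat_of_ord q))) (att x).
Proof.
rewrite /safe_of => -> /=; set e := ek _.
transitivity [seq nth 0 (att x) i | i <- iota e (size (att x) - e)].
  congr map; case: (leqP e (size (att x))) => le; last first.
    rewrite (@eq_in_filter _ _ pred0) ?filter_pred0; last by move=> i; rewrite mem_iota /=; lia.
    by have -> : size (att x) - e = 0 by lia.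
  rewrite -{1}[size (att x)](subnKC le) iotaD filter_cat add0n.
  rewrite (@eq_in_filter _ _ pred0) ?filter_pred0; last by move=> i; rewrite mem_iota /=; lia.
  by rewrite (@eq_in_filter _ _ predT) ?filter_predT // => i; rewrite mem_iota /=; lia.
by rewrite map_nth_iota // take_oversize // size_drop.
Qed.

Variables (g : 'I_(nD S)) (k l : nat) (hs : 'I_nC -> nat) (t : cterm nC).
Hypothesis rdok : rd_ok arC c0 P g (rec_rd k l hs t).
Hypothesis g_nrm : ek (ent (nat_of_ord g)) = k.+1.
Hypothesis h_nrm : forall c, ek (ent (hs c)) = arC c + k.
Hypothesis t_wf : wf_ct arC t.

Let rd := rec_rd k l hs t.
Let K := lg (nodes g rd).
Let m := size (subs t).
Let L := size (pre rd).
Notation reach := (clos_refl_trans nat (succ (gatt K))).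

Let LE : L = m + (k + l). Proof. exact: size_rec_rd. Qed.
Let topo : topological (nodes g rd) := nodes_topo P_gt0 rdok.
Let t_in : t \in subs t. Proof. by rewrite mem_subs subterms_refl. Qed.
Let index_lt : index t (subs t) < m. Proof. by rewrite index_mem. Qed.

Let node_sub j : j < m -> nth None (nodes g rd) j =
  Some (inl (chd (nth d0 (subs t) j)), [seq index u (subs t) | u <- cargs (nth d0 (subs t) j)]).
Proof.
move=> jm; rewrite nth_nodes_pre; last by rewrite -/L LE; apply: leq_trans jm (leq_addr _ _).
by rewrite nth_cat size_map jm (nth_map d0).
Qed.

Let node_var j : m <= j -> j < L -> nth None (nodes g rd) j = None.
Proof.
move=> mj jL; rewrite nth_nodes_pre // nth_cat size_map ltnNge mj /=.
by rewrite nth_nseq if_same.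
Qed.

Let nrm_root : knrm K L = index t (subs t) :: iota m k.
Proof.
rewrite /knrm (nrm_ofE P_gt0 _ (glab_root g rd)) gatt_root g_nrm /= take_iota.
by congr (_ :: iota _ _); lia.
Qed.

Let safe_root : ksafe K L = iota (m + k) l.
Proof.
rewrite /ksafe (safe_ofE _ (glab_root g rd)) gatt_root g_nrm /= drop_iota.
by congr (iota _ _); lia.
Qed.

Let L_lt : L < size (nodes g rd). Proof. exact: root_lt. Qed.

Let trep_sub n j : j < m -> j < n ->
  trep_f (glab K) (gatt K) n j = embed S (nth d0 (subs t) j).
Proof.
elim: n j => // n IH j jm jn; rewrite /= node_sub //=.
rewrite [in RHS](ctE (nth d0 (subs t) j)) /=; congr GApp; rewrite -map_comp.
apply/eq_in_map => u uin /=; have [ui uj] := nth_subs_arg jm uin.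
rewrite IH ?index_mem //; last exact: leq_trans uj jn.
by rewrite nth_index.
Qed.

Let trep_var n j : m <= j -> j < L -> trep_f (glab K) (gatt K) n j = GVar S j.
Proof. by move=> mj jL; case: n => //= n; rewrite node_var. Qed.

Let size_ksub_root : size (tnodes (ksub K L)) = L.+1.
Proof.
rewrite -(size_iota 0 L.+1); apply/perm_size/uniq_perm; rewrite ?undup_uniq ?iota_uniq //.
by move=> x; rewrite (ksub_root P_gt0 rdok) mem_iota.
Qed.

(** All safe arguments are variables, so the graph is its own normal part. Its nodes represent
    distinct ground terms, distinct variables, and the one term headed by [g]. *)
Let root_max_shared : max_shared (cap_nrm (ksub K L)).
Proof.
have -> : cap_nrm (ksub K L) = ksub K L.
  rewrite /cap_nrm ifF //; apply/negbTE/hasPn => v.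
  rewrite [safe_of _ _ _]safe_root mem_iota => /andP[mv vlt]; apply/negPn/eqP.
  by rewrite /= node_var // ?LE; lia.
move=> u v; rewrite !(ksub_root P_gt0 rdok) -/L /trep size_ksub_root.
set tr := trep_f _ _ _.
have cases x : x <= L -> [\/ x < m /\ tr x = embed S (nth d0 (subs t) x),
    m <= x < L /\ tr x = GVar S x | x = L /\ exists us, tr x = GApp (inr g) us].
  rewrite leq_eqVlt => /predU1P[->|xL].
    by constructor 3; split=> //; rewrite /tr /= nth_nodes_root; eexists.
  case: (ltnP x m) => xm.
    by constructor 1; split=> //; apply: trep_sub => //; apply: leqW.
  by constructor 2; split; [apply/andP | apply: trep_var].
move=> /cases[[um ->]|[_ ->]|[-> [us ->]]] /cases[[vm ->]|[_ ->]|[-> [us' ->]]] uv //.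
  by move/embed_inj/eqP; rewrite nth_uniq ?subs_uniq // => /eqP; exact: uv.
all: by [case: (nth d0 _ _) | case].
Qed.

Let root_closed v : v \in knrm K L -> glab K v <> None -> Defs.closed (ksub K v).
Proof.
rewrite nrm_root inE => /predU1P[-> _ x|]; last first.
  by rewrite mem_iota => /andP[mv vlt] []; rewrite /= node_var // LE; lia.
have ilt : index t (subs t) < size (nodes g rd).
  by apply: ltn_trans L_lt; rewrite LE; apply: leq_trans index_lt (leq_addr _ _).
move/(ksub_lgP topo _ ilt)/(lg_reach_le topo) => xle.
by rewrite /= node_sub // (leq_ltn_trans xle).
Qed.

Let root_bound : size (undup ([seq v <- knrm K L | glab K v == None] ++
  flatten [seq tnodes (ksub K v) | v <- ksafe K L])) <= k + l.
Proof.
rewrite -(size_iota m (k + l)); apply: uniq_leq_size; first exact: undup_uniq.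
move=> x; rewrite mem_undup mem_cat mem_filter nrm_root safe_root mem_iota.
case/orP=> [/andP[xN]|/flattenP[s /mapP[v + ->]]].
  rewrite inE => /predU1P[xE|]; last by rewrite mem_iota; lia.
  by move: xN; rewrite xE /= node_sub.
rewrite mem_iota => /andP[mv vlt].
have vL : v < L by rewrite LE; lia.
move/(ksub_lgP topo _ (ltn_trans vL L_lt))/reach_cons => [->|[y]]; first by lia.
by rewrite /= node_var //; lia.
Qed.

(** The right-hand side omits the left root, which leaves at most [L + m] nodes. A proper subterm of
    [t] lies below an immediate argument of [t], and these arguments are normal arguments of the
    resulting root. *)
Let res_size : size (tnodes (ksub K (res rd))) <= size (tnodes (ksub K L)) +
  size (undup (flatten [seq tnodes (ksub K v) | v <- knrm K (res rd)])).
Proof.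
have le1 : size (tnodes (ksub K (res rd))) <= L + m.
  have nin : size [seq x <- iota 0 (L.+1 + m) | x != L] = L + m.
    have := count_predC (pred1 L) (iota 0 (L.+1 + m)).
    rewrite count_uniq_mem ?iota_uniq // mem_iota size_iota size_filter.
    rewrite add0n leq0n ltn_addr // => H; exact: (@addnI 1 _ (L + m) H).
  rewrite -nin; apply: uniq_leq_size; first exact: undup_uniq.
  move=> x /(ksub_lgP topo _ (res_lt rdok)) r.
  have xL := reach_res_neq P_gt0 rdok r.
  have := leq_ltn_trans (lg_reach_le topo r) (res_lt rdok).
  by rewrite size_nodes size_map mem_filter mem_iota -/L -/m (introF eqP xL) => ->.
rewrite size_ksub_root; apply: leq_trans le1 _; rewrite addSnnS leq_add2l.
set U := undup _.
have -> : m = size (iota 0 m) by rewrite size_iota.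
(* The one node to spare, gained from the left root, is spent on [t], the only subterm that need not
   lie below an immediate argument. *)
rewrite -[_.+1]/(size (index t (subs t) :: U)).
apply: uniq_leq_size; first exact: iota_uniq.
move=> j; rewrite mem_iota => /andP[_ jm]; rewrite inE.
case: eqP => //= jt; rewrite mem_undup.
have sin : nth d0 (subs t) j \in subterms t by rewrite -mem_subs mem_nth.
have jE : index (nth d0 (subs t) j) (subs t) = j by rewrite index_uniq ?subs_uniq.
have [s_eq|[v vin sv]] : nth d0 (subs t) j = t \/
    exists2 v, v \in cargs t & nth d0 (subs t) j \in subterms v.
  by move: sin; rewrite (ctE t) => /subtermsP.
  by case: jt; rewrite -jE s_eq.
have v_in : v \in subs t by move: t_in; rewrite (ctE t) !mem_subs => /subterms_arg; apply.
have vm : index v (subs t) < m by rewrite index_mem.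
have vL : index v (subs t) < L by rewrite LE; apply: leq_trans vm (leq_addr _ _).
apply/flattenP; exists (tnodes (ksub K (index v (subs t)))); last first.
  apply/(ksub_lgP topo _ (ltn_trans vL L_lt)).
  rewrite -jE; apply: (proj1 (preach_reach P_gt0 rdok vL _)).
  by apply: rec_rd_reach => //; rewrite -mem_subs.
apply: (map_f (fun v => tnodes (ksub K v))).
have resL : L < res rd by rewrite /= LE; lia.
have E : nth None (nodes g rd) (res rd) = Some (tolab arC c0 P (inr (hs (chd t))),
   [seq index u (subs t) | u <- cargs t] ++ iota m (k + l) ++
            [seq L.+1 + index u (subs t) | u <- cargs t]).
  have -> : res rd = L.+1 + index t (subs t) by rewrite /= LE.
  rewrite nth_nodes_rest onth_map onthE (nth_map d0) ?index_mem // nth_index //=.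
  by rewrite LE.
have [s [a [sE aE [asz _ _] us]]] := rest_labelled P_gt0 rdok resL (res_lt rdok).
rewrite /= E /= in sE aE; case: sE => sE.
have hE : (inord (hs (chd t)) : 'I_(nD S)) = hs (chd t) :> nat.
  have jlt : index t (subs t) < size (rest rd) by rewrite size_map.
  have [s' [a' [+ _ us']]] := code_at P_gt0 rdok jlt.
  rewrite onth_map onthE (nth_map d0) ?index_mem // nth_index //= => -[Es _].
  by rewrite -Es in us'; case: us'.
rewrite /knrm (nrm_ofE P_gt0 (q := inord (hs (chd t))) (gatt K) _) /= E // hE h_nrm.
have tsz : size (cargs t) = arC (chd t) by move: t_wf; rewrite (ctE t) /= => /andP[/eqP].
by rewrite take_cat size_map tsz ltnNge leq_addr /= mem_cat (map_f (index^~ (subs t))).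
Qed.

Lemma rec_rule_conds d : k + l <= d -> inf_rule_conds d (rule_of g rd).
Proof.
move=> kd; split=> /=; [exact: root_max_shared | exact: root_closed | | exact: res_size].
exact: leq_trans root_bound kd.
Qed.
End RecursionRule.

Lemma list_bound (T : Type) (F : T -> nat) s : exists b, forall x, List.In x s -> F x <= b.
Proof.
elim: s => [|x s [b H]]; first by exists 0.
exists (F x + b) => y [->|/H]; lia.
Qed.

(** A case distinction by excluded middle: either the symbol owns no finite rule, or all of its
    rules occur in one list. *)
Lemma fin_rules_bounded nC (arC : 'I_nC -> nat) (S : sig arC) (R : rule S -> Prop) g :
  exists b, forall p, in_G_fin R p -> glab (rK p) (rl p) = Some (inr g) ->
    size (tnodes (ksub (rK p) (rr p))) <= b.
Proof.
have [Dg|/NNPP[s sP]] := classic (D_inf R g).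
  by exists 0 => p [Rp nG] lE; case: nG; split=> //; exists g.
have [b H] := list_bound (fun p => size (tnodes (ksub (rK p) (rr p)))) s.
by exists b => p [Rp _] lE; apply/H/sP.
Qed.

Theorem mainTheorem9 (nC : nat) (arC : 'I_nC -> nat)
  (Hconst : exists c : 'I_nC, arC c = 0)
  (k l : nat) (f : fn nC) (Hf : GSR arC k l f) :
  exists (S : sig arC),
    (forall (c : 'I_nC) (i : nat), snrm S (inl c) i = false) /\
    exists (R : rule S -> Prop) (g : 'I_(nD S)),
      [/\ (forall p, R p -> wf_rule p /\ constructor_rule p),
          computes R g k l f,
          prec_terminating R &
          exists d : nat,
            [/\ (forall s : sym S, ar s <= d),
                (forall p, in_G_fin R p -> size (tnodes (ksub (rK p) (rr p))) <= d) &
                (forall p, in_G_inf R p -> inf_rule_conds d p)]].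
Proof.
case: Hconst => c0 _.
have [|P [j [P_ok [jlt <- <- <-]]]] := @GSR_compilable nC arC c0 k l f Hf [::].
  by move=> i.
rewrite cat0s in P_ok jlt *.
have P_gt0 : 0 < size P by apply: leq_ltn_trans jlt.
have okP (g : 'I_(nD (psig arC c0 P))) := entry_okP P_ok (ord_ltP P_gt0 g).
exists (psig arC c0 P); split=> //.
exists (@prules nC arC c0 P), (inord j); split.
- move=> _ [g [rd [erd ->]]]; have [/(_ rd erd)[rdok _] _ _ _] := okP g.
  by split; [apply: rule_of_wf | apply: rule_of_constructor].
- exact: program_computes.
- exists (@prec nC arC c0 P); split; first exact: prec_precedence.
  move=> _ [g [rd [erd ->]]]; have [/(_ rd erd)[rdok _] _ _ _] := okP g.
  exact: pt_rule.
have [b bP] := fin_all_exists (fin_rules_bounded (@prules nC arC c0 P)).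
(* The three summands account for constructor arities, arities of defined symbols, and right-hand
   sides of the finite part; the second also covers condition (iii). *)
pose d := \max_(c : 'I_nC) arC c + \max_(g < nD (psig arC c0 P)) arD (psig arC c0 P) g
          + \max_(g < nD (psig arC c0 P)) b g.
have arD_le (g : 'I_(nD (psig arC c0 P))) : arD (psig arC c0 P) g <= d.
  by apply: leq_trans (leq_addr _ _); apply: leq_trans (leq_addl _ _); apply: leq_bigmax.
exists d; split.
- case=> [c|g]; last exact: arD_le.
  by do 2!apply: leq_trans (leq_addr _ _); apply: (leq_bigmax (F := arC)).
- move=> p pfin; have [[g [rd [erd pE]]] _] := pfin.
  have := bP g p pfin; rewrite {1 2}pE => /(_ (glab_root g rd)) /leq_trans; apply.
  by apply: leq_trans (leq_addl _ _); apply: leq_bigmax.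
move=> _ [[g [rd [erd ->]]] [g' [+ inf]]].
rewrite [glab _ _]glab_root => -[gE]; rewrite -{}gE in inf.
have [/(_ rd erd)[rdok _] _ [[s sP]|[hs [k' [l' [ekE elE hP erP]]]]] _] := okP g.
  (* An entry with finitely many raw rules contradicts [D_inf], so only recursion entries remain. *)
  case: inf; exists [seq rule_of g rd | rd <- s] => _ [g1 [rd1 [erd1 ->]]].
  rewrite [glab _ _]glab_root => -[E]; rewrite E in erd1 *.
  by apply: List.in_map; apply: sP.
have [t wt rdE] := erP rd erd; rewrite rdE in rdok *.
apply: rec_rule_conds => //; apply: leq_trans (arD_le g).
by rewrite /= ekE elE addSn leqW.
Qed.
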